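(* Let $S=F[[x,y]]/(x^2y)$, and let $T'_{CM}$ be the first Cantor--Bendixson derivative of $\mathrm{ZCM}_S$. The module $C=xyS$ is isolated in $T'_{CM}$ by the minimal pair $(C,xy)$ over $(D,xy)$, where $D=xS$; in particular the Cantor--Bendixson rank of $C$ in $\mathrm{ZCM}_S$ equals $1$.
   Context: $F$ is an algebraically closed field of characteristic different from $2$. An arbitrary $S$-module $M$ is Cohen--Macaulay (CM) if $\operatorname{Soc}(M)=0$, i.e. for $m\in M$, $mx=my=0$ implies $m=0$. $C=xyS$ and $D=xS$ are ideals of $S$ regarded as $S$-modules. A pp-formula (in one free variable $v$) is a formula $\exists\,\overline w\,(\overline w A=v\,\overline b)$ in the language of $S$-modules; $\varphi(K)$ is the set of elements of $K$ satisfying $\varphi$. $\mathrm{ZCM}_S$ is the space whose points are isomorphism classes of indecomposable pure injective CM $S$-modules, with basic open sets $(\varphi/\psi)=\{K:\varphi(K)\not\subseteq\psi(K)\}$. For a finitely generated CM-module $M$ and $m\in M$, the pointed module $(M,m)$ denotes the pp-formula $\varphi$ generating the pp-type of $m$ in $M$, so $\varphi(K)=\{f(m): f\in\operatorname{Hom}_S(M,K)\}$ for every $S$-module $K$. The first derivative $T'_{CM}$ of $\mathrm{ZCM}_S$ is obtained by deleting the isolated points (which have rank $0$); the isolated points of $T'_{CM}$ have Cantor--Bendixson rank $1$. To a closed subset $T$ of $\mathrm{ZCM}_S$ corresponds the lattice of pp-formulae modulo equivalence on all modules in $T$. A pair $\varphi/\psi$ is minimal in $T$ if $\psi<\varphi$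 in this lattice and nothing lies strictly between; a point $P\in T$ is isolated in $T$ by the minimal pair $\varphi/\psi$ if $(\varphi/\psi)\cap T=\{P\}$. *)

(* Defs.v *)
From HB Require Import structures.
From mathcomp Require Import all_boot all_order all_algebra.
From mathcomp Require Import boolp.

Set Implicit Arguments.
Unset Strict Implicit.
Unset Printing Implicit Defensive.

Import GRing.Theory.
Local Open Scope ring_scope.
Local Open Scope quotient_scope.

(* [bcoef f i j] is the coefficient of x^i y^j. *)
Record bpseries (R : Type) := BPSeries { bcoef : nat -> nat -> R }.

HB.instance Definition _ (R : Type) := gen_eqMixin (bpseries R).
HB.instance Definition _ (R : Type) := gen_choiceMixin (bpseries R).

Section BPSeriesRing.
Variable R : comNzRingType.
Implicit Types f g h : bpseries R.
Implicit Types a b c : nat -> nat -> R.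

Definition cauchy a b (i j : nat) : R :=
  \sum_(k < i.+1) \sum_(l < j.+1) a k l * b (i - k)%N (j - l)%N.

Definition bps0 : bpseries R := BPSeries (fun _ _ => 0).
Definition bps1 : bpseries R :=
  BPSeries (fun i j => ((i == 0%N) && (j == 0%N))%:R).
Definition bpsX : bpseries R :=
  BPSeries (fun i j => ((i == 1%N) && (j == 0%N))%:R).
Definition bpsY : bpseries R :=
  BPSeries (fun i j => ((i == 0%N) && (j == 1%N))%:R).
Definition bps_opp f : bpseries R := BPSeries (fun i j => - bcoef f i j).
Definition bps_add f g : bpseries R :=
  BPSeries (fun i j => bcoef f i j + bcoef g i j).
Definition bps_mul f g : bpseries R := BPSeries (cauchy (bcoef f) (bcoef g)).

Lemma bpsP f g : (forall i j, bcoef f i j = bcoef g i j) -> f = g.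
Proof.
case: f => f; case: g => g /= fg; congr BPSeries.
by apply/funext => i; apply/funext => j.
Qed.

Lemma bps_addA : associative bps_add.
Proof. by move=> f g h; apply: bpsP => i j /=; rewrite addrA. Qed.
Lemma bps_addC : commutative bps_add.
Proof. by move=> f g; apply: bpsP => i j /=; rewrite addrC. Qed.
Lemma bps_add0 : left_id bps0 bps_add.
Proof. by move=> f; apply: bpsP => i j /=; rewrite add0r. Qed.
Lemma bps_addN : left_inverse bps0 bps_opp bps_add.
Proof. by move=> f; apply: bpsP => i j /=; rewrite addNr. Qed.

HB.instance Definition _ :=
  GRing.isZmodule.Build (bpseries R) bps_addA bps_addC bps_add0 bps_addN.

Let pcoef (p : {poly {poly R}}) i j : R := p`_i`_j.
Let trunc n a : {poly {poly R}} := \poly_(i < n) \poly_(j < n) a i j.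

Let cauchy_poly p q i j : cauchy (pcoef p) (pcoef q) i j = pcoef (p * q) i j.
Proof.
by rewrite /pcoef coefM coef_sum; apply: eq_bigr => k _; rewrite coefM.
Qed.

Let truncE n a i j : (i < n)%N -> (j < n)%N -> pcoef (trunc n a) i j = a i j.
Proof. by move=> ltin ltjn; rewrite /pcoef !coef_poly ltin coef_poly ltjn. Qed.

Let eq_cauchy a a' b b' i j :
  (forall k l, (k <= i)%N -> (l <= j)%N -> a k l = a' k l) ->
  (forall k l, (k <= i)%N -> (l <= j)%N -> b k l = b' k l) ->
  cauchy a b i j = cauchy a' b' i j.
Proof.
move=> eqa eqb; apply: eq_bigr => k _; apply: eq_bigr => l _.
by rewrite eqa ?eqb ?leq_subr // -ltnS ltn_ord.
Qed.

Let cauchyE n a b i j : (i < n)%N -> (j < n)%N ->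
  cauchy a b i j = pcoef (trunc n a * trunc n b) i j.
Proof.
move=> ltin ltjn; rewrite -cauchy_poly.
by apply: eq_cauchy => k l leki lelj;
  rewrite truncE // ?(leq_ltn_trans leki) ?(leq_ltn_trans lelj).
Qed.

Lemma bps_mulC : commutative bps_mul.
Proof.
move=> f g; apply: bpsP => i j /=.
have [ltin ltjn] : (i < (maxn i j).+1)%N /\ (j < (maxn i j).+1)%N.
  by rewrite !ltnS leq_maxl leq_maxr.
by rewrite !(cauchyE _ _ ltin ltjn) mulrC.
Qed.

Lemma bps_mulA : associative bps_mul.
Proof.
move=> f g h; apply: bpsP => i j /=.
pose n := (maxn i j).+1; pose T s := trunc n (bcoef s).
have [ltin ltjn] : (i < n)%N /\ (j < n)%N.
  by rewrite !ltnS leq_maxl leq_maxr.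
transitivity (pcoef (T f * (T g * T h)) i j).
  rewrite -cauchy_poly; apply: eq_cauchy => k l leki lelj.
    by rewrite truncE // ?(leq_ltn_trans leki) ?(leq_ltn_trans lelj).
  by apply: cauchyE; rewrite ?(leq_ltn_trans leki) ?(leq_ltn_trans lelj).
rewrite mulrA -cauchy_poly; apply: eq_cauchy => k l leki lelj.
  by symmetry; apply: cauchyE;
    rewrite ?(leq_ltn_trans leki) ?(leq_ltn_trans lelj).
by rewrite truncE // ?(leq_ltn_trans leki) ?(leq_ltn_trans lelj).
Qed.

Lemma bps_mul1 : left_id bps1 bps_mul.
Proof.
move=> f; apply: bpsP => i j; rewrite /= /cauchy.
rewrite big_ord_recl [X in _ + X]big1 => [|k _].
  rewrite addr0 big_ord_recl big1 => [|l _]; last by rewrite /= mul0r.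
  by rewrite /= mul1r addr0 !subn0.
by apply: big1 => l _; rewrite /= mul0r.
Qed.

Lemma bps_mulDl : left_distributive bps_mul bps_add.
Proof.
move=> f g h; apply: bpsP => i j; rewrite /= /cauchy -big_split.
apply: eq_bigr => k _; rewrite -big_split; apply: eq_bigr => l _.
by rewrite /= mulrDl.
Qed.

Lemma bps1_neq0 : bps1 != bps0.
Proof.
apply/eqP => /(congr1 (fun f => bcoef f 0 0)) /= /eqP.
by rewrite oner_eq0.
Qed.

HB.instance Definition _ := GRing.Zmodule_isComNzRing.Build (bpseries R)
  bps_mulA bps_mulC bps_mul1 bps_mulDl bps1_neq0.

End BPSeriesRing.

Definition principal (A : comNzRingType) (a : A) : {pred A} :=
  fun s => `[< exists t, s = a * t >].

Section X2Y.
Variable F : fieldType.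

Definition x2y_ideal : {pred bpseries F} := principal (bpsX F ^+ 2 * bpsY F).

Lemma x2y_idealr_closed : idealr_closed x2y_ideal.
Proof.
split.
- by apply/asboolP; exists 0; rewrite mulr0.
- apply/asboolP => -[t] /(congr1 (fun f => bcoef f 0 0)).
  rewrite -mulrA expr2 -mulrA => /eqP /=.
  by rewrite /cauchy !big_ord1 /= mul0r oner_eq0.
- move=> a _ _ /asboolP[u ->] /asboolP[v ->]; apply/asboolP.
  by exists (a * u + v); rewrite mulrDr mulrCA.
Qed.

HB.instance Definition _ := isIdealr.Build (bpseries F) x2y_ideal
  x2y_idealr_closed.

Definition ringS : Type := {ideal_quot x2y_ideal}.
HB.instance Definition _ := GRing.ComNzRing.on ringS.

Definition xS : ringS := \pi_({ideal_quot x2y_ideal}) (bpsX F).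
Definition yS : ringS := \pi_({ideal_quot x2y_ideal}) (bpsY F).

End X2Y.

Section PrincipalModule.
Variables (A : comNzRingType) (a : A).

Lemma principal_subsemimod_closed :
  subsemimod_closed (principal a : {pred A^o}).
Proof.
split; first split.
- by apply/asboolP; exists 0; rewrite mulr0.
- move=> _ _ /asboolP[u ->] /asboolP[v ->]; apply/asboolP.
  by exists (u + v); rewrite mulrDr.
- move=> c _ /asboolP[u ->]; apply/asboolP.
  by exists (c * u); rewrite mulrCA.
Qed.

(* The principal ideal aA, as an A-module. *)
Definition pideal : Type := {s : A^o | s \in principal a}.

HB.instance Definition _ := [isSub of pideal for @sval _ _].
HB.instance Definition _ := [Choice of pideal by <:].
HB.instance Definition _ :=
  GRing.SubChoice_isSubLmodule.Build A A^o (principal a) pideal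
    principal_subsemimod_closed.

End PrincipalModule.

Section Modules.
Variable A : comNzRingType.
Implicit Types M N K : lmodType A.

Definition lmod_iso M N : Prop := exists f : {linear M -> N}, bijective f.

Definition trivial_lmod M : Prop := forall m : M, m = 0.

Definition indecomposable M : Prop :=
  ~ trivial_lmod M /\
  forall N1 N2 : lmodType A, lmod_iso M (N1 * N2)%type ->
    trivial_lmod N1 \/ trivial_lmod N2.

(* Finite systems of linear equations with constants in M which are solvable
   in N are solvable in M. *)
Definition pure_embedding M N (f : {linear M -> N}) : Prop :=
  injective f /\
  forall (n m : nat) (E : 'M[A]_(n, m)) (c : 'I_m -> M),
    (exists w : 'I_n -> N, forall j, \sum_i E i j *: w i = f (c j)) ->
    exists w : 'I_n -> M, forall j, \sum_i E i j *: w i = c j.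

Definition pure_injective K : Prop :=
  forall (M N : lmodType A) (f : {linear M -> N}), pure_embedding f ->
  forall g : {linear M -> K}, exists h : {linear N -> K},
    forall m, h (f m) = g m.

(* The pp-formula [exists w, w E = v b] in the free variable v; since A is
   commutative, left modules stand for right modules. *)
Record ppform := PPForm {
  pp_vars : nat;
  pp_eqns : nat;
  pp_mx : 'M[A]_(pp_vars, pp_eqns);
  pp_row : 'rV[A]_pp_eqns }.
Implicit Types phi psi theta : ppform.

Definition pp_sat phi K (v : K) : Prop :=
  exists w : 'I_(pp_vars phi) -> K,
    forall j, \sum_i pp_mx phi i j *: w i = pp_row phi 0 j *: v.

Definition pp_sub phi psi K : Prop :=
  forall v : K, pp_sat phi v -> pp_sat psi v.

(* phi represents the pointed module (M, m): it generates the pp-type of m. *)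
Definition generates_pptype phi M (m : M) : Prop :=
  pp_sat phi m /\
  forall psi, pp_sat psi m -> forall K, pp_sub phi psi K.

(* Points are isomorphism classes of modules; they are handled through
   representatives, and sets of points as isomorphism-invariant predicates. *)
Definition pair_open phi psi K : Prop := ~ pp_sub phi psi K.

Section Space.
Variable Z : lmodType A -> Prop.
Implicit Types T U : lmodType A -> Prop.

Definition zg_open U : Prop :=
  exists B : ppform -> ppform -> Prop, forall K, Z K ->
    (U K <-> exists phi psi, B phi psi /\ pair_open phi psi K).

Definition isolated_in T P : Prop :=
  T P /\ exists U, zg_open U /\ forall K, T K -> (U K <-> lmod_iso K P).

Definition cb_derivative T K : Prop := T K /\ ~ isolated_in T K.

Fixpoint cb_iter (n : nat) : lmodType A -> Prop :=
  if n is n'.+1 then cb_derivative (cb_iter n') else Z.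

Definition cb_rank P (n : nat) : Prop := isolated_in (cb_iter n) P.

End Space.

Section Lattice.
Variable T : lmodType A -> Prop.

Definition pp_le psi phi : Prop := forall K, T K -> pp_sub psi phi K.

Definition pp_lt psi phi : Prop := pp_le psi phi /\ ~ pp_le phi psi.

Definition minimal_pair phi psi : Prop :=
  pp_lt psi phi /\ ~ exists theta, pp_lt psi theta /\ pp_lt theta phi.

Definition isolated_by P phi psi : Prop :=
  T P /\ forall K, T K -> (pair_open phi psi K <-> lmod_iso K P).

End Lattice.

End Modules.

Section ZCM.
Variable F : fieldType.

Definition CM (M : lmodType (ringS F)) : Prop :=
  forall m : M, xS F *: m = 0 -> yS F *: m = 0 -> m = 0.

Definition ZCM (M : lmodType (ringS F)) : Prop :=
  [/\ indecomposable M, pure_injective M & CM M].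

Definition T_CM1 : lmodType (ringS F) -> Prop := cb_derivative ZCM ZCM.

Definition modC : lmodType (ringS F) := pideal (xS F * yS F).
Definition modD : lmodType (ringS F) := pideal (xS F).

Lemma xy_in_C : xS F * yS F \in principal (xS F * yS F).
Proof. by apply/asboolP; exists 1; rewrite mulr1. Qed.

Lemma xy_in_D : xS F * yS F \in principal (xS F).
Proof. by apply/asboolP; exists (yS F). Qed.

Definition xyC : modC := exist _ (xS F * yS F) xy_in_C.
Definition xyD : modD := exist _ (xS F * yS F) xy_in_D.

End ZCM.

(* Main.v *)
Require Import Defs.
From HB Require Import structures.
From mathcomp Require Import all_boot all_order all_algebra.
From mathcomp Require Import boolp classical_sets functions.

(** Write phi(v) for [x v = 0] and psi(v) for [v = y u] with [x y u = 0]; these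
are the formulae of (C, xy) and (D, xy).  Let phi_m(v) (resp. chi_m(v)) say
that [x v = 0] and [y^m v] lies in xK (resp. xyK), so that
psi = psi + chi_0 <= psi + phi_0 <= psi + chi_1 <= psi + phi_1 <= ... <= phi.
Let v satisfy phi but not psi in an indecomposable CM-module K.  If v lies in
no psi + phi_m, some homomorphism K -> C maps v to xy; it splits, so K is
isomorphic to C.  Otherwise K opens one of the consecutive pairs of the chain,
and in the same way phi_m / (psi + chi_m) forces K to be the ideal
(xy, y^(m+1)), while chi_(m+1) / (psi + phi_m) forces K to be the ideal
(xy, x^2 + y^(m+1)); so K is isolated by that pair.  A homomorphism from K to
such an ideal of S amounts to a coherent sequence of F-linear functionals on
K, so it exists as soon as a certain vector avoids a certain subspace.  The
same device gives pure injectivity.  Finally C is not isolated, being a limit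
of the points (xy, y^(m+1)). *)

(** K need not be finitely generated, so a map out of K cannot be given on generators, and
    infinitely many coefficients have to be prescribed. Multiplication by y shifts the coefficients
    of x y^(j+1), multiplication by x those of x^(j+2), so together they amount to one functional on
    the colimit of K x K along (y, x). A prescription can therefore fail only through a relation in
    a single degree, of the form y^(m+d) v = y^(m+d+1) a + ...; the CM condition cancels y^d from
    it. This is why one formula of index m decides about an ideal with exponent m + 1, whereas C
    needs psi + phi_d for all d. The chain itself comes from the relations between the generators of
    the ideals: x y^(m+1) = y^m (xy) becomes divisibility of y^m v by x, and xy (x^2 + y^(m+1)) =
    y^(m+1) (xy) becomes divisibility of y^(m+1) v by xy, with v in the place of xy. *)

Set Implicit Arguments.
Unset Strict Implicit.
Unset Printing Implicit Defensive.

Import GRing.Theory.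
Local Open Scope ring_scope.

(** * Coefficients in S *)

Section SeriesRing.
Variable F : fieldType.
Local Notation P := (bpseries F).
Local Notation S := (ringS F).

Lemma bcoefXM (f : P) i j :
  bcoef (bpsX F * f) i j = if i is i'.+1 then bcoef f i' j else 0.
Proof.
case: i => [|i] /=; rewrite /cauchy.
  by rewrite big_ord1 big1 // => l _; rewrite /= mul0r.
rewrite big_ord_recl [X in X + _]big1 => [|l _]; last by rewrite /= mul0r.
rewrite add0r big_ord_recl [X in _ + X]big1 => [|k _].
  rewrite addr0 big_ord_recl [X in _ + X]big1 => [|l _].
    by rewrite /= mul1r addr0 !subn0 subSS subn0.
  by rewrite /= mul0r.
by apply: big1 => l _; rewrite /= mul0r.
Qed.

Lemma bcoefYM (f : P) i j :
  bcoef (bpsY F * f) i j = if j is j'.+1 then bcoef f i j' else 0.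
Proof.
rewrite /= /cauchy big_ord_recl [X in _ + X]big1 => [|k _]; last first.
  by apply: big1 => l _; rewrite /= mul0r.
rewrite addr0; case: j => [|j]; first by rewrite big_ord1 /= mul0r.
rewrite big_ord_recl /= mul0r add0r big_ord_recl [X in _ + X]big1 => [|l _].
  by rewrite /= mul1r addr0 subn0 subSS subn0.
by rewrite /= mul0r.
Qed.

Definition bpsC (a : F) : P :=
  BPSeries (fun i j => if (i == 0%N) && (j == 0%N) then a else 0).

Lemma bcoefCM a (f : P) i j : bcoef (bpsC a * f) i j = a * bcoef f i j.
Proof.
rewrite /= /cauchy big_ord_recl [X in _ + X]big1 => [|k _]; last first.
  by apply: big1 => l _; rewrite /= mul0r.
rewrite addr0 big_ord_recl [X in _ + X]big1 => [|l _]; last first.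
  by rewrite /= mul0r.
by rewrite /= addr0 !subn0.
Qed.

Definition piS : P -> S := \pi_({ideal_quot (@x2y_ideal F)})%qT.

HB.instance Definition _ := GRing.RMorphism.on piS.

Lemma piS_surj (s : S) : exists f, s = piS f.
Proof.
exists (@generic_quotient.repr _ {ideal_quot (@x2y_ideal F)} s).
by rewrite /piS generic_quotient.reprK.
Qed.

Lemma piS_eq0 f : piS f = 0 <-> exists g, f = bpsX F ^+ 2 * bpsY F * g.
Proof.
have -> : (0 : S) = piS 0 by rewrite rmorph0.
rewrite /piS; split=> [/eqP|[g fE]].
  by rewrite -Quotient.idealrBE subr0 => /asboolP.
by apply/eqP; rewrite -Quotient.idealrBE subr0; apply/asboolP; exists g.
Qed.

(* The monomials x^i y^j outside the ideal (x^2 y). *)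
Definition inreg (i j : nat) := (i < 2)%N || (j == 0%N).

Lemma piS_eq0P f :
  piS f = 0 <-> forall i j, inreg i j -> bcoef f i j = 0.
Proof.
rewrite piS_eq0; split=> [[g ->] i j|f0].
  rewrite expr2 -!mulrA bcoefXM; case: i => [//|i].
  by rewrite bcoefXM; case: i => [//|i]; rewrite bcoefYM; case: j.
exists (BPSeries (fun i j => bcoef f i.+2 j.+1)); apply: bpsP => i j.
rewrite expr2 -!mulrA bcoefXM; case: i => [|i]; first exact: f0.
rewrite bcoefXM; case: i => [|i]; first exact: f0.
by rewrite bcoefYM; case: j => [|j] //; apply: f0.
Qed.

Lemma piS_eqP f g :
  piS f = piS g <-> forall i j, inreg i j -> bcoef f i j = bcoef g i j.
Proof.
split=> [fg i j ij|fg].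
  apply/eqP; rewrite -subr_eq0; apply/eqP.
  apply: ((piS_eq0P (f - g)).1 _ i j ij).
  by rewrite rmorphB /= fg subrr.
apply/eqP; rewrite -subr_eq0 -rmorphB; apply/eqP.
by apply/piS_eq0P => i j ij; rewrite /= fg // subrr.
Qed.

(* Junk value 0 on the monomials lying in the ideal. *)
Definition cf (s : S) i j : F :=
  if inreg i j then
    bcoef (@generic_quotient.repr _ {ideal_quot (@x2y_ideal F)} s) i j
  else 0.

Lemma cf_piS f i j : inreg i j -> cf (piS f) i j = bcoef f i j.
Proof.
move=> ij; rewrite /cf ij; apply: ((piS_eqP _ _).1 _ i j ij).
exact: generic_quotient.reprK.
Qed.

Definition mkS (a : nat -> nat -> F) : S := piS (BPSeries a).

Lemma cf_mkS a i j : inreg i j -> cf (mkS a) i j = a i j.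
Proof. exact: cf_piS. Qed.

Lemma cfP s t : (forall i j, inreg i j -> cf s i j = cf t i j) -> s = t.
Proof.
case: (piS_surj s) (piS_surj t) => f -> [g ->] fg.
by apply/piS_eqP => i j ij; rewrite -!(cf_piS _ ij) fg.
Qed.

Lemma cf_ext s t :
  (forall j, cf s 0 j = cf t 0 j) -> (forall j, cf s 1 j = cf t 1 j) ->
  (forall i, cf s i.+2 0 = cf t i.+2 0) -> s = t.
Proof.
move=> s0 s1 s2; apply: cfP => -[|[|i]] j // /eqP ->; exact: s2.
Qed.

Lemma cf0 i j : cf 0 i j = 0.
Proof.
case ij: (inreg i j); last by rewrite /cf ij.
by rewrite -(rmorph0 piS) cf_piS.
Qed.

Lemma cfD s t i j : cf (s + t) i j = cf s i j + cf t i j.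
Proof.
case ij: (inreg i j); last by rewrite /cf ij addr0.
case: (piS_surj s) (piS_surj t) => f -> [g ->].
by rewrite -rmorphD !cf_piS.
Qed.

Lemma cfN s i j : cf (- s) i j = - cf s i j.
Proof. by apply/eqP; rewrite -addr_eq0 -cfD addNr cf0. Qed.

Lemma cfB s t i j : cf (s - t) i j = cf s i j - cf t i j.
Proof. by rewrite cfD cfN. Qed.

Definition constS (a : F) : S := piS (bpsC a).

Lemma cfC a s i j : cf (constS a * s) i j = a * cf s i j.
Proof.
case ij: (inreg i j); last by rewrite /cf ij mulr0.
by case: (piS_surj s) => f ->; rewrite -rmorphM !cf_piS // bcoefCM.
Qed.

Local Notation x := (xS F).
Local Notation y := (yS F).

Lemma cfX0 s j : cf (x * s) 0 j = 0.
Proof.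
case: (piS_surj s) => f ->; rewrite -[x]/(piS (bpsX F)) -rmorphM cf_piS //.
by rewrite bcoefXM.
Qed.

Lemma cfXS s i j : inreg i.+1 j -> cf (x * s) i.+1 j = cf s i j.
Proof.
move=> ij; case: (piS_surj s) => f ->.
rewrite -[x]/(piS (bpsX F)) -rmorphM !cf_piS ?bcoefXM //.
by move: ij; rewrite /inreg => /orP[/ltnW ->|->]; rewrite ?orbT.
Qed.

Lemma cfY0 s i : cf (y * s) i 0 = 0.
Proof.
case: (piS_surj s) => f ->; rewrite -[y]/(piS (bpsY F)) -rmorphM cf_piS ?bcoefYM //.
by rewrite /inreg orbT.
Qed.

Lemma cfYS s i j : (i < 2)%N -> cf (y * s) i j.+1 = cf s i j.
Proof.
move=> i2; case: (piS_surj s) => f ->.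
by rewrite -[y]/(piS (bpsY F)) -rmorphM !cf_piS ?bcoefYM // /inreg i2.
Qed.

Lemma cfYn n s i j : (i < 2)%N ->
  cf (y ^+ n * s) i j = if (j < n)%N then 0 else cf s i (j - n).
Proof.
move=> i2; elim: n j => [|n IHn] j; first by rewrite expr0 mul1r subn0.
rewrite exprS -mulrA; case: j => [|j]; first by rewrite cfY0.
by rewrite cfYS // IHn.
Qed.

Lemma cf_1 i j : inreg i j -> cf 1 i j = ((i == 0%N) && (j == 0%N))%:R.
Proof. by move=> ij; rewrite -(rmorph1 piS) cf_piS. Qed.

Lemma xxy0 : x * x * y = 0.
Proof.
have -> : x * x * y = piS (bpsX F ^+ 2 * bpsY F) by rewrite rmorphM rmorphXn.
by apply/piS_eq0; exists 1; rewrite mulr1.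
Qed.

Lemma constS_is_zmod : zmod_morphism constS.
Proof.
move=> a b; rewrite /constS -rmorphB; congr piS.
by apply: bpsP => i j /=; case: ifP; rewrite ?subr0.
Qed.
HB.instance Definition _ := GRing.isZmodMorphism.Build F S constS constS_is_zmod.

Lemma constS_is_monoid : monoid_morphism constS.
Proof.
split=> [|a b]; rewrite /constS.
  rewrite -(rmorph1 piS); congr piS.
  by apply: bpsP => i j /=; case: ifP.
rewrite -rmorphM; congr piS; apply: bpsP => i j; rewrite bcoefCM /=.
by case: ifP; rewrite ?mulr0.
Qed.
HB.instance Definition _ := GRing.isMonoidMorphism.Build F S constS constS_is_monoid.

Lemma ringS_decomp s : exists s1 s2, s = constS (cf s 0 0) + x * s1 + y * s2.
Proof.
(* The monomials x y^j with j > 0 could go to either side; here y takes everything that it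
   divides. *)
exists (mkS (fun i j => if j is 0%N then cf s i.+1 j else 0)).
exists (mkS (fun i j => cf s i j.+1)).
apply: cf_ext => [j|j|i]; rewrite !cfD -[constS _]mulr1 cfC cf_1 //=;
  rewrite ?cfX0 ?cfXS ?cf_mkS ?cfY0 /inreg ?orbT //.
- case: j => [|j]; first by rewrite cfY0 mulr1 !addr0.
  by rewrite cfYS // cf_mkS // mulr0 !add0r.
- case: j => [|j]; first by rewrite cfY0 mulr0 add0r addr0.
  by rewrite cfYS // cf_mkS // mulr0 !add0r.
- by rewrite mulr0 add0r addr0.
Qed.

Lemma xdivP s : (forall j, cf s 0 j = 0) -> exists t, s = x * t.
Proof.
move=> s0; exists (mkS (fun i j => cf s i.+1 j)).
by apply: cf_ext => [j|j|i]; rewrite ?cfX0 ?cfXS ?cf_mkS // /inreg orbT.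
Qed.

Lemma cfXY s i j : cf (x * y * s) i j =
  if (i == 1%N) && (0 < j)%N then cf s 0 j.-1 else 0.
Proof.
case ij: (inreg i j); last first.
  by move: ij; rewrite /cf /inreg; case: i => [|[|i]] //= ->.
rewrite -mulrA; case: i ij => [|i] ij; first by rewrite cfX0.
rewrite cfXS //; case: j ij => [|j] ij; first by rewrite cfY0 andbF.
by case: i ij => // ij; rewrite cfYS.
Qed.

Lemma xydivP s : (forall j, cf s 0 j = 0) -> (forall i, cf s i 0 = 0) ->
  exists t, s = x * y * t.
Proof.
move=> s0 s1; exists (mkS (fun i j => cf s 1 j.+1)).
apply: cf_ext => [j|j|i]; rewrite cfXY ?s0 ?s1 //=.
by case: j => [|j]; rewrite ?s1 //= cf_mkS.
Qed.

Lemma ann_x s : x * s = 0 -> exists t, s = x * y * t.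
Proof.
move=> xs0; apply: xydivP => [j|i].
  by rewrite -(@cfXS s 0 j) // xs0 cf0.
by rewrite -(@cfXS s i 0) /inreg ?orbT // xs0 cf0.
Qed.

Lemma ann_xy s : x * y * s = 0 -> exists t, s = x * t.
Proof.
by move=> s0; apply: xdivP => j; have := cfXY s 1 j.+1; rewrite s0 cf0.
Qed.

(** An element killed by x lies in xyS, and y acts injectively there; so S is CM. *)
Lemma ringS_socle0 s : x * s = 0 -> y * s = 0 -> s = 0.
Proof.
move=> /ann_x[t ->] ys0; apply: cf_ext => [j|j|i]; rewrite cf0.
- by rewrite cfXY.
- by rewrite -(cfYS _ _ (isT : (1 < 2)%N)) ys0 cf0.
- by rewrite cfXY.
Qed.

End SeriesRing.

(** * Linear functionals *)

Section Separation.
Variables (F : fieldType) (V : lmodType F).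

Definition subspace (W : set V) : Prop :=
  W 0 /\ forall (a : F) u v, W u -> W v -> W (a *: u + v).

(** A subspace maximal among those that contain W and avoid e is a complement of the line through e,
    and the coordinate along e is the functional. *)
Lemma linear_separation (W : set V) (e : V) : subspace W -> ~ W e ->
  exists f : {scalar V}, (forall w, W w -> f w = 0) /\ f e = 1.
Proof.
move=> subW We.
pose P (A : set V) :=
  A = set0 \/ [/\ subspace A, (W `<=` A)%classic & ~ A e].
have [|A [[A0|[[A0 Alin] WA Ae]] Amax]] := @Zorn_bigcup V P.
- move=> C CP Ctot; have [C0|] := pselect (forall X, C X -> X = set0).
    by left; apply/seteqP; split=> // v [X CX]; rewrite (C0 _ CX).
  move=> /existsNP[X /not_implyP[CX X0]]; right.
  have CXP Y v : C Y -> Y v -> [/\ subspace Y, (W `<=` Y)%classic & ~ Y e].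
    by move=> CY Yv; case: (CP _ CY) => // Y0; move: Yv; rewrite Y0.
  have [X00|[[X00 _] WX _]] := CP X CX; first by case: X0.
  split; last 2 first.
  - by move=> w Ww; exists X => //; apply: WX.
  - by move=> [Y CY Ye]; case: (CXP _ _ CY Ye).
  - split; first by exists X.
    move=> a u v [Y CY Yu] [Z CZ Zv].
    have [YZ|ZY] := Ctot Y Z CY CZ.
      exists Z => //; have [[_ Zl] _ _] := CXP _ _ CZ Zv.
      by apply: Zl => //; apply: YZ.
    exists Y => //; have [[_ Yl] _ _] := CXP _ _ CY Yu.
    by apply: Yl => //; apply: ZY.
- have [W0 _] := subW; exfalso; apply: (Amax W); last by right; split.
  rewrite A0; split=> // W00; exact: (W00 0 W0).
have AZ a u : A u -> A (a *: u) by move=> Au; rewrite -[_ *: _]addr0; apply: Alin.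
have AD u v : A u -> A v -> A (u + v).
  by move=> Au Av; rewrite -[u]scale1r; apply: Alin.
have coord u : exists c, A (u - c *: e).
  have [Au|Au] := pselect (A u); first by exists 0; rewrite scale0r subr0.
  pose B : set V := fun v => exists a c, A a /\ v = a + c *: u.
  have AB : (A `<=` B)%classic.
    by move=> a Aa; exists a, 0; rewrite scale0r addr0.
  have Bu : B u by exists 0, 1; rewrite scale1r add0r.
  have sB : subspace B.
    split; first exact: AB.
    move=> k _ _ [a [c [Aa ->]]] [a' [c' [Aa' ->]]].
    exists (k *: a + a'), (k * c + c'); split; first exact: Alin.
    by rewrite scalerDr scalerDl !scalerA addrACA.
  have [Be|Be] := pselect (B e); last first.
    exfalso; apply: (Amax B); last by right; split=> // w /WA /AB.
    by split=> // BA; apply/Au/BA.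
  have [a [c [Aa ea]]] := Be.
  have c0 : c != 0.
    by apply/eqP => c0; apply: Ae; rewrite ea c0 scale0r addr0.
  exists c^-1; rewrite ea scalerDr scalerA mulVf // scale1r.
  by rewrite opprD addrCA subrr addr0 -scaleNr; apply: AZ.
have coord_uniq u c d : A (u - c *: e) -> A (u - d *: e) -> c = d.
  move=> Ac Ad; apply/eqP/negPn/negP => cd; apply: Ae.
  have d0 : d - c != 0 by rewrite subr_eq0 eq_sym.
  rewrite -[e]scale1r -(mulVf d0) -scalerA; apply: (AZ).
  have -> : (d - c) *: e = (u - c *: e) + (-1) *: (u - d *: e).
    by rewrite scaleN1r opprB scalerBl [RHS]addrC addrA addrNK.
  by apply: AD => //; apply: AZ.
pose g u := sval (cid (coord u)).
have gP u : A (u - g u *: e) by rewrite /g; case: cid.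
have glin : scalar g.
  move=> k u v; apply: (@coord_uniq (k *: u + v)) => //.
  rewrite scalerDl -scalerA opprD addrACA -scalerBr.
  exact: Alin.
pose gM := GRing.isLinear.Build F V F^o *%R g glin.
pose gL : {scalar V} := HB.pack g gM.
exists gL; split=> [w Ww|]; apply: (@coord_uniq _ _ _ (gP _)).
  by rewrite scale0r subr0; apply: WA.
by rewrite scale1r subrr.
Qed.

End Separation.

Section Engine.
Variables (F : fieldType) (U : lmodType F) (T : {linear U -> U}).

(** T^n u_0 + T^(n-1) u_1 + ... + u_n: the sum of the first terms of u, all carried to the n-th copy
    of U in the colimit along T. *)
Fixpoint horner_acc (u : nat -> U) (n : nat) : U :=
  if n is n'.+1 then T (horner_acc u n') + u n else u 0%N.

Lemma horner_acc_linear n (a : F) u v :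
  horner_acc (a *: u + v) n = a *: horner_acc u n + horner_acc v n.
Proof.
elim: n => [|n IHn] //=.
by rewrite IHn linearP scalerDr addrACA.
Qed.

Lemma horner_acc_extend u n k : (forall j, (n < j)%N -> u j = 0) ->
  horner_acc u (n + k) = iter k T (horner_acc u n).
Proof.
move=> u0; elim: k => [|k IHk]; first by rewrite addn0.
by rewrite addnS /= IHk u0 ?addr0 // ltnS leq_addr.
Qed.

Definition single (j : nat) (u : U) : nat -> U := fun i => if i == j then u else 0.

Lemma horner_acc_single j u : horner_acc (single j u) j = u.
Proof.
case: j => [|j] //=; rewrite {2}/single eqxx.
suff -> : forall n, (n <= j)%N -> horner_acc (single j.+1 u) n = 0.
- by rewrite linear0 add0r.
- by [].
elim=> [|n IHn] // nj /=; rewrite IHn ?(ltnW nj) // linear0 add0r /single.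
by rewrite eqSS ltn_eqF.
Qed.

(* The graded pieces [W d] prescribe the values of the functional of index
   [m + d]; the functionals glue to one functional on the colimit of
   U -> U -> ... along T, where [linear_separation] yields it. *)
Lemma shifted_functionals (m : nat) (W : nat -> U -> F -> Prop) :
  (forall d, W d 0 0) ->
  (forall d a u c u' c', W d u c -> W d u' c' ->
     W d (a *: u + u') (a * c + c')) ->
  (forall d u c, W d u c -> W d.+1 (T u) c) ->
  (forall d, ~ W d 0 1) ->
  exists l : nat -> {scalar U},
    (forall j u, l j.+1 (T u) = l j u) /\
    (forall d u c, W d u c -> l (m + d)%N u = c).
Proof.
move=> W0 Wlin WT W1.
pose V : lmodType F := ((nat -> U) * F^o)%type.
have Wraise d k u c : W d u c -> W (d + k)%N (iter k T u) c.
  by move=> Wu; elim: k => [|k IHk]; rewrite ?addn0 // addnS; apply: WT.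
(* The pairs (u, c) such that u, carried to the copy of index m + d, is to take the value c. *)
pose B : set V := fun p => exists d,
  (forall j, (m + d < j)%N -> p.1 j = 0) /\ W d (horner_acc p.1 (m + d)) p.2.
have Braise (p : V) d k :
    (forall j, (m + d < j)%N -> p.1 j = 0) -> W d (horner_acc p.1 (m + d)) p.2 ->
    W (d + k)%N (horner_acc p.1 (m + (d + k))) p.2.
  by move=> p0 Wp; rewrite addnA horner_acc_extend //; apply: Wraise.
have iterT0 k : iter k T 0 = 0 by elim: k => [|k /= ->] //; rewrite linear0.
have acc0 n : horner_acc 0 n = 0.
  by elim: n => [|n IHn] //=; rewrite IHn linear0 addr0.
have subB : subspace B.
  split; first by exists 0%N; split=> //=; rewrite acc0.
  move=> a p p' [d [p0 Wp]] [d' [p0' Wp']]; exists (d + d')%N; split=> [j|].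
    rewrite addnA => lt_j /=.
    rewrite /GRing.add /= /GRing.scale /=.
    rewrite p0 ?p0' ?scaler0 ?addr0 //.
      by apply: leq_ltn_trans lt_j; rewrite leq_add2r leq_addr.
    by apply: leq_ltn_trans lt_j; rewrite leq_addr.
  change (W (d + d')%N (horner_acc (a *: p.1 + p'.1) (m + (d + d')))
            (a * p.2 + p'.2)).
  rewrite horner_acc_linear.
  apply: Wlin; first exact: Braise.
  by rewrite (addnC d); apply: Braise.
have Be : ~ B (0, 1).
  by move=> [d [_]] /=; rewrite acc0; apply: W1.
have [f [fB f1]] := linear_separation subB Be.
have single_lin j a u v : single j (a *: u + v) = a *: single j u + single j v.
  apply/funext => i; rewrite /single.
  rewrite /GRing.add /= /GRing.scale /=.
  by case: eqP; rewrite ?scaler0 ?addr0.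
(* The functional f vanishes on B and takes (0, 1) to 1, so f (u, 0) = - c for (u, c) in B; hence
   the sign. *)
pose l0 j (u : U) : F := - f ((single j u, 0) : V).
have l0lin j : scalar (l0 j).
  move=> a u v; rewrite /l0 single_lin.
  rewrite -[((a *: single j u + _, 0) : V)]/((a *: single j u + single j v, 0) : V).
  have -> : ((a *: single j u + single j v, 0) : V) =
       a *: ((single j u, 0) : V) + ((single j v, 0) : V).
    by congr pair; rewrite /= scaler0 addr0.
  by rewrite linearP opprD mulrN.
pose l j : {scalar U} :=
  HB.pack (l0 j) (GRing.isLinear.Build F U F^o *%R (l0 j) (l0lin j)).
exists l; split=> [j u|d u c Wu] /=; rewrite /l0.
  congr (- _); apply/eqP; rewrite -subr_eq0 -linearB; apply/eqP/fB.
  have -> : ((single j.+1 (T u), 0) : V) - ((single j u, 0) : V) =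
    ((-1) *: single j u + single j.+1 (T u), 0) :> V.
    by congr pair; rewrite /= ?subr0 // scaleN1r addrC.
  (* The two terms cancel in the copy of index j + 1, hence in all later ones. *)
  exists j.+1; split=> [i lt_i|].
    rewrite /= /GRing.add /= /GRing.scale /= /single.
    have lt_j : (j.+1 < i)%N by apply: leq_ltn_trans lt_i; apply: leq_addl.
    by rewrite !gtn_eqF ?(ltnW lt_j) // scaler0 addr0.
  rewrite /= addnC horner_acc_extend => [|i lt_i]; last first.
    rewrite /GRing.add /= /GRing.scale /= /single.
    by rewrite !gtn_eqF ?(ltnW lt_i) // scaler0 addr0.
  rewrite horner_acc_linear horner_acc_single /= horner_acc_single.
  rewrite /single gtn_eqF // addr0 scaleN1r addNr.
  by rewrite iterT0.
have -> : c = f ((0, c) : V).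
  have -> : ((0, c) : V) = c *: ((0, 1) : V).
    by congr pair; rewrite /= ?scaler0 // /GRing.scale /= mulr1.
  by rewrite linearZ /= f1 mulr1.
rewrite -linearN.
apply/eqP; rewrite -subr_eq0 -linearB; apply/eqP.
have -> : - ((single (m + d) u, 0) : V) - ((0, c) : V) =
   (-1) *: ((single (m + d) u, c) : V).
  by congr pair; rewrite /= scaleN1r ?subr0 // oppr0 sub0r.
rewrite linearZ /= fB ?mulr0 //; exists d; split=> [j lt_j|] /=.
  by rewrite /single gtn_eqF.
by rewrite horner_acc_single.
Qed.
End Engine.

(** * Homomorphisms into S *)

Section HomEngine.
Variable F : fieldType.
Local Notation S := (ringS F).
Local Notation x := (xS F).
Local Notation y := (yS F).
Local Notation "a %:S" := (@constS F a) (at level 2, format "a %:S").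

Definition base_fmod (K : lmodType S) : Type := K.
HB.instance Definition _ (K : lmodType S) := GRing.Zmodule.on (base_fmod K).

Section FMod.
Variable K : lmodType S.
Definition fscale (a : F) (k : base_fmod K) : base_fmod K := a%:S *: (k : K).

Fact fscaleA a b k : fscale a (fscale b k) = fscale (a * b) k.
Proof. by rewrite /fscale scalerA rmorphM. Qed.
Fact fscale1 : left_id 1 fscale.
Proof. by move=> k; rewrite /fscale rmorph1 scale1r. Qed.
Fact fscaleDr : right_distributive fscale +%R.
Proof. by move=> a k l; rewrite /fscale scalerDr. Qed.
Fact fscaleDl k : {morph fscale^~ k : a b / a + b}.
Proof. by move=> a b; rewrite /fscale rmorphD scalerDl. Qed.
HB.instance Definition _ :=
  GRing.Zmodule_isLmodule.Build F (base_fmod K) fscaleA fscale1 fscaleDr fscaleDl.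

Lemma fmodZ a (k : K) : a *: (k : base_fmod K) = a%:S *: k.
Proof. by []. Qed.
End FMod.

Variable K : lmodType S.

(* The defect h(sk) - s h(k) lies in every power of (x, y). *)
Lemma linear_of_generators (h : K -> S) :
  {morph h : k l / k + l} ->
  (forall a k, h (a%:S *: k) = a%:S * h k) ->
  (forall k, h (x *: k) = x * h k) -> (forall k, h (y *: k) = y * h k) ->
  forall s k, h (s *: k) = s * h k.
Proof.
move=> hD hC hX hY s k.
suff defect n : forall s k i j, inreg i j -> (i + j < n)%N ->
    cf (h (s *: k)) i j = cf (s * h k) i j.
  by apply: cfP => i j ij; apply: (defect (i + j).+1).
elim: n => [//|n IHn] {}s {}k i j ij lt_ij.
have [s1 [s2 ->]] := ringS_decomp s.
rewrite !scalerDl !hD hC -!scalerA hX hY !mulrDl -!mulrA !cfD; congr (_ + _ + _).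
  case: i ij lt_ij => [|i] ij lt_ij; first by rewrite !cfX0.
  rewrite !cfXS // IHn //.
  by move: ij; rewrite /inreg => /orP[/ltnW ->|->]; rewrite ?orbT.
case: j ij lt_ij => [|j] ij lt_ij; first by rewrite !cfY0.
have i2 : (i < 2)%N by move: ij; rewrite /inreg orbF.
by rewrite !cfYS // IHn ?/inreg ?i2 // -addnS.
Qed.

(** Here q_j and r_j are to be the coefficients of x y^(j+1) and x^(j+2) in h, those of 1 and x
    being 0. The coefficient of y^(j+1) in h(k) is then forced to be q_j(xk), and the hypotheses on
    q and r are what linearity over x and y demands. *)
Lemma hom_of_functionals (q r : nat -> K -> F) :
  (forall j, {morph q j : k l / k + l}) -> (forall j, {morph r j : k l / k + l}) ->
  (forall j a k, q j (a%:S *: k) = a * q j k) ->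
  (forall j a k, r j (a%:S *: k) = a * r j k) ->
  (forall j k, q j.+1 (y *: k) = q j k) -> (forall k, q 0%N (y *: k) = 0) ->
  (forall j k, q j (x *: (x *: k)) = 0) ->
  (forall j k, r j.+1 (x *: k) = r j k) -> (forall k, r 0%N (x *: k) = 0) ->
  (forall j k, r j (y *: k) = 0) ->
  exists h : {linear K -> S^o}, forall k,
    [/\ cf (h k) 0 0 = 0, cf (h k) 1 0 = 0,
        forall j, cf (h k) 1 j.+1 = q j k & forall i, cf (h k) i.+2 0 = r i k].
Proof.
move=> qD rD qC rC qY qY0 qX rX rX0 rY.
pose c (k : K) (i j : nat) : F := match i, j with
  | 0%N, j.+1 => q j (x *: k)
  | 1%N, j.+1 => q j k
  | i.+2, 0%N => r i k
  | _, _ => 0 end.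
pose h0 k : S := mkS (c k).
have h0E k i j : inreg i j -> cf (h0 k) i j = c k i j by move=> ij; rewrite cf_mkS.
have reg2 i : inreg i.+2 0 by rewrite /inreg orbT.
have h0D : {morph h0 : k l / k + l}.
  move=> k l; apply: cf_ext => [[|j]|[|j]|i];
    by rewrite cfD !h0E //= ?addr0 ?scalerDr ?qD ?rD.
have h0C a k : h0 (a%:S *: k) = a%:S * h0 k.
  apply: cf_ext => [[|j]|[|j]|i]; rewrite cfC !h0E //= ?mulr0 ?rC -?qC //.
  by rewrite !scalerA mulrC.
have h0X k : h0 (x *: k) = x * h0 k.
  apply: cf_ext => [[|j]|[|j]|i]; rewrite ?cfX0 ?cfXS //.
  - by rewrite h0E.
  - by rewrite h0E //=.
  - by rewrite !h0E.
  - by rewrite !h0E.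
  - rewrite h0E //=; case: i => [|i]; first by rewrite rX0 h0E.
    by rewrite rX h0E.
have h0Y k : h0 (y *: k) = y * h0 k.
  apply: cf_ext => [[|j]|[|j]|i]; rewrite ?cfY0 ?cfYS // h0E //=.
  - rewrite scalerA mulrC -scalerA; case: j => [|j]; first by rewrite qY0 h0E.
    by rewrite qY h0E.
  - by case: j => [|j]; rewrite ?qY0 ?qY h0E.
have h0S := linear_of_generators h0D h0C h0X h0Y.
have h0lin : linear (h0 : K -> S^o) by move=> a u v; rewrite h0D h0S.
pose h : {linear K -> S^o} :=
  HB.pack (h0 : K -> S^o) (GRing.isLinear.Build S K S^o *:%R h0 h0lin).
by exists h => k; split=> *; rewrite /= h0E.
Qed.

(** [W d A B c] prescribes q_(m+d)(A) + r_(m+d)(B) = c; smaller indices are reached through q_j(k) =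
    q_(m+j)(y^m k) and r_j(k) = r_(m+j)(x^m k). The last four hypotheses are the boundary conditions
    of [hom_of_functionals] carried to index m + d. In applications the substance lies in the
    consistency condition [~ W d 0 0 1]. *)
Lemma hom_engine (m : nat) (W : nat -> K -> K -> F -> Prop) :
  (forall d a A B c A' B' c', W d A B c -> W d A' B' c' ->
     W d (a%:S *: A + A') (a%:S *: B + B') (a * c + c')) ->
  (forall d A B c, W d A B c -> W d.+1 (y *: A) (x *: B) c) ->
  (forall d, ~ W d 0 0 1) ->
  (forall d k, W d (y ^+ (m + d).+1 *: k) 0 0) ->
  (forall d k, W d (x *: (x *: k)) 0 0) ->
  (forall d k, W d 0 (x ^+ (m + d).+1 *: k) 0) ->
  (forall d k, W d 0 (y *: k) 0) ->
  exists h : {linear K -> S^o},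
    (forall k, cf (h k) 0 0 = 0 /\ cf (h k) 1 0 = 0) /\
    (forall d A B c, W d A B c ->
      cf (h A) 1 (m + d).+1 + cf (h B) (m + d).+2 0 = c).
Proof.
move=> Wlin WT W1 WY WXX WX WyB.
pose U : lmodType F := (base_fmod K * base_fmod K)%type.
pose T0 (u : U) : U := (y *: (u.1 : K), x *: (u.2 : K)).
have T0lin : linear T0.
  move=> a u v; congr pair; rewrite /= scalerDr; congr (_ + _);
  by rewrite !fmodZ !scalerA mulrC.
pose T : {linear U -> U} := HB.pack T0 (GRing.isLinear.Build F U U *:%R T0 T0lin).
have [|d a u c u' c' Wu Wu'|d u c Wu|d|l [lT lW]] :=
  @shifted_functionals F U T m (fun d u c => W d u.1 u.2 c).
- by move=> d; have := WY d 0; rewrite scaler0.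
- exact: Wlin.
- exact: WT.
- exact: W1.
pose q j (k : K) := l j ((k : base_fmod K), 0).
pose r j (k : K) := l j (0, (k : base_fmod K)).
have qD j : {morph q j : k k' / k + k'}.
  by move=> k k'; rewrite /q -linearD; congr (l j _); congr pair; rewrite /= addr0.
have rD j : {morph r j : k k' / k + k'}.
  by move=> k k'; rewrite /r -linearD; congr (l j _); congr pair; rewrite /= addr0.
have qC j a k : q j (a%:S *: k) = a * q j k.
  rewrite /q -[RHS]linearZ; congr (l j _); congr pair; by rewrite /= ?scaler0.
have rC j a k : r j (a%:S *: k) = a * r j k.
  rewrite /r -[RHS]linearZ; congr (l j _); congr pair; by rewrite /= ?scaler0.
have qY j k : q j.+1 (y *: k) = q j k.
  by rewrite /q -[RHS]lT; congr (l _ _); congr pair; rewrite /= scaler0.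
have rX j k : r j.+1 (x *: k) = r j k.
  by rewrite /r -[RHS]lT; congr (l _ _); congr pair; rewrite /= scaler0.
have qYn n j k : q (n + j)%N (y ^+ n *: k) = q j k.
  by elim: n => [|n IHn]; rewrite ?expr0 ?scale1r // exprS -scalerA qY.
have rXn n j k : r (n + j)%N (x ^+ n *: k) = r j k.
  by elim: n => [|n IHn]; rewrite ?expr0 ?scale1r // exprS -scalerA rX.
have lqr d A B c : W d A B c -> q (m + d)%N A + r (m + d)%N B = c.
  move=> /(lW d (A, B)) <-; rewrite /q /r -linearD; congr (l _ _).
  by congr pair; rewrite /= ?addr0 ?add0r.
have q0 j : q j 0 = 0 by rewrite /q linear0.
have r0 j : r j 0 = 0 by rewrite /r linear0.
have [||||h hE] := hom_of_functionals qD rD qC rC qY _ _ rX.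
- by move=> k; rewrite -(qYn m) scalerA -exprSr;
    have /lqr := WY 0%N k; rewrite addn0 r0 addr0.
- move=> j k; rewrite -(qYn m).
  have /lqr := WXX j (y ^+ m *: k).
  by rewrite r0 addr0 !scalerA -!mulrA [x * y ^+ m]mulrC [x * (_ * _)]mulrCA.
- by move=> k; rewrite -(rXn m) scalerA -exprSr;
    have /lqr := WX 0%N k; rewrite addn0 q0 add0r.
- move=> j k; rewrite -(rXn m).
  have /lqr := WyB j (x ^+ m *: k).
  by rewrite q0 add0r !scalerA mulrC.
exists h; split=> [k|d A B c /lqr <-]; first by case: (hE k).
by case: (hE A) (hE B) => _ _ -> _ [_ _ _ ->].
Qed.

End HomEngine.

(** * Extension of partial homomorphisms to C and to (xy, y^(m+1)) *)

Section Extension.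
Variable F : fieldType.
Local Notation S := (ringS F).
Local Notation x := (xS F).
Local Notation y := (yS F).
Variable K : lmodType S.
Implicit Types h : {linear K -> S^o}.

Lemma linear_mulS h s k : h (s *: k) = s * h k :> S.
Proof. by rewrite linearZ. Qed.

Lemma cfXn n (s : S) i : cf (x ^+ n * s) (n + i) 0 = cf s i 0.
Proof.
elim: n => [|n IHn]; first by rewrite expr0 mul1r.
by rewrite exprS -mulrA addSn cfXS // /inreg orbT.
Qed.

Lemma cf_lower n s j : cf s 1 j = cf (y ^+ n * s) 1 (n + j).
Proof. by rewrite cfYn // ltnNge leq_addr /= addKn. Qed.

(** G is the graph of the partial homomorphism, and V d consists of elements on which the
    coefficient of x y^(m+d+1) has to vanish. A contradictory prescription is an equation A0 + A1 =
    0 with A0 in the domain of G and A1 in V d, so the last hypothesis is all the consistency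
    needed; it also makes G single-valued where it matters. *)
Lemma partial_hom_extension (m : nat) (V : nat -> K -> Prop) (G : K -> S -> Prop) :
  (forall d s k k', V d k -> V d k' -> V d (s *: k + k')) ->
  (forall d k, V d k -> V d.+1 (y *: k)) ->
  (forall d k, V d (y ^+ (m + d).+1 *: k)) ->
  (forall d k, V d (x *: (x *: k))) ->
  G 0 0 ->
  (forall s k t k' t', G k t -> G k' t' -> G (s *: k + k') (s * t + t')) ->
  (forall k t i, G k t -> cf t i 0 = 0) ->
  (forall d k t, G k t -> V d k -> cf t 1 (m + d).+1 = 0) ->
  exists h : {linear K -> S^o},
    [/\ forall k i, cf (h k) i 0 = 0,
        forall d k, V d k -> cf (h k) 1 (m + d).+1 = 0
      & forall k t, G k t -> h k = t].
Proof.
move=> Vlin VT VY VXX G0 Glin Gcol GV.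
have V0 d : V d 0 by have := VY d 0; rewrite scaler0.
have VN d k : V d k -> V d (- k).
  by move=> Vk; rewrite -scaleN1r -[_ *: _]addr0; apply: Vlin.
have GZ s k t : G k t -> G (s *: k) (s * t).
  by move=> Gk; rewrite -[_ *: _]addr0 -[_ * _]addr0; apply: Glin.
(* B is left free, which forces all coefficients of pure powers of x to vanish. *)
pose W d (A B : K) (c : F) := exists A0 t A1,
  [/\ G A0 t, V d A1, A = A0 + A1 & c = cf t 1 (m + d).+1].
have WV d A B : V d A -> W d A B 0.
  by move=> VA; exists 0, 0, A; split; rewrite ?add0r ?cf0.
have [|d A B c|d|d k|d k|d k|d k|h [hcol hW]] := @hom_engine F K m W;
  [| | |exact/WV/VY|exact/WV/VXX|exact/WV/V0|exact/WV/V0|].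
- move=> d a A B c A' B' c' [A0 [t [A1 [GA VA -> ->]]]].
  move=> [A0' [t' [A1' [GA' VA' -> ->]]]].
  exists (constS a *: A0 + A0'), (constS a * t + t'), (constS a *: A1 + A1').
  split; [exact: Glin|exact: Vlin|by rewrite scalerDr addrACA|].
  by rewrite cfD cfC.
- move=> [A0 [t [A1 [GA VA -> ->]]]].
  exists (y *: A0), (y * t), (y *: A1).
  by split; [exact: GZ|exact: VT|rewrite scalerDr|rewrite addnS cfYS].
- move=> [A0 [t [A1 [GA VA A01 /esym]]]].
  rewrite (GV d A0 t) // => [/esym/eqP|]; first by rewrite oner_eq0.
  have -> : A0 = - A1 by apply/eqP; rewrite -addr_eq0 -A01.
  exact: VN.
have h0 d B : cf (h B) (m + d).+2 0 = 0.
  by have /hW := WV d 0 B (V0 d); rewrite linear0 cf0 add0r.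
have hcol0 k i : cf (h k) i 0 = 0.
  case: i => [|[|i]]; [by case: (hcol k)|by case: (hcol k)|].
  by rewrite -(cfXn m) -linear_mulS 2!addnS h0.
have hWd d A B c : W d A B c -> cf (h A) 1 (m + d).+1 = c.
  by move=> /hW; rewrite hcol0 addr0.
exists h; split=> [//|d k Vk|k t Gk]; first exact: (hWd d k 0 0 (WV _ _ _ Vk)).
have hG k' t' j : G k' t' -> cf (h k') 1 j.+1 = cf t' 1 j.+1.
  move=> Gk'; rewrite (cf_lower m) -linear_mulS addnS.
  rewrite (hWd j _ 0 (cf (y ^+ m * t') 1 (m + j).+1)).
    by rewrite -addnS -cf_lower.
  exists (y ^+ m *: k'), (y ^+ m * t'), 0.
  by split; rewrite ?addr0 //; apply: GZ.
apply: cf_ext => [[|j]|[|j]|i]; rewrite ?hcol0 ?(Gcol k) //; last exact: hG.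
by rewrite -(@cfXS _ (h k)) // -linear_mulS (hG _ (x * t)) ?cfXS //; apply: GZ.
Qed.

(** The coefficient of y^(d+1) in h(z) is that of x y^(d+1) in h(xz); so the image lies in xyS once
    these coefficients vanish on xK, which is therefore put into V d. *)
Lemma extension_C (G : K -> S -> Prop) :
  G 0 0 ->
  (forall s k t k' t', G k t -> G k' t' -> G (s *: k + k') (s * t + t')) ->
  (forall k t, G k t -> exists u, t = x * y * u) ->
  (forall d a z t, G (y ^+ d.+1 *: a + x *: z) t -> cf t 1 d.+1 = 0) ->
  exists h : {linear K -> S^o},
    (forall k, exists u, h k = x * y * u) /\ forall k t, G k t -> h k = t.
Proof.
move=> G0 Glin Gim GV.
pose V d (A : K) := exists a z, A = y ^+ d.+1 *: a + x *: z.
have [||||||h [h0 hV hG]] := @partial_hom_extension 0 V G _ _ _ _ G0 Glin.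
- move=> d s _ _ [a [z ->]] [a' [z' ->]]; exists (s *: a + a'), (s *: z + z').
  by rewrite !scalerDr addrACA !scalerA ![s * _]mulrC.
- move=> d _ [a [z ->]]; exists a, (y *: z).
  by rewrite scalerDr !scalerA -exprS mulrC.
- by move=> d k; exists k, 0; rewrite scaler0 addr0.
- by move=> d k; exists 0, (x *: k); rewrite scaler0 add0r.
- by move=> k t i /Gim[u ->]; rewrite cfXY andbF.
- by move=> d k t Gk [a [z kE]]; apply: (GV d a z); rewrite -kE.
exists h; split=> // k; apply: xydivP => [[|j]|i]; rewrite ?h0 //.
rewrite -(@cfXS _ (h k)) // -linear_mulS; apply: (hV j).
by exists 0, k; rewrite scaler0 add0r.
Qed.

(* The ideal (xy, y^(m+1)). *)
Definition lamS m (s : S) :=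
  (forall j, (j <= m)%N -> cf s 0 j = 0) /\ forall i, cf s i 0 = 0.

(** The coefficient of x y^(m+d+1) in h(y^(d+1) x z) is that of y^m in h(z); hence the third
    summand. Lower powers of y are treated by multiplying z by a power of y. *)
Lemma extension_Lam m (G : K -> S -> Prop) :
  G 0 0 ->
  (forall s k t k' t', G k t -> G k' t' -> G (s *: k + k') (s * t + t')) ->
  (forall k t, G k t -> lamS m t) ->
  (forall d a b z t,
    G (y ^+ (m + d).+1 *: a + x *: (x *: b) + y ^+ d.+1 *: (x *: z)) t ->
    cf t 1 (m + d).+1 = 0) ->
  exists h : {linear K -> S^o},
    (forall k, lamS m (h k)) /\ forall k t, G k t -> h k = t.
Proof.
move=> G0 Glin Gim GV.
pose V d (A : K) := exists a b z,
  A = y ^+ (m + d).+1 *: a + x *: (x *: b) + y ^+ d.+1 *: (x *: z).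
have [||||||h [h0 hV hG]] := @partial_hom_extension m V G _ _ _ _ G0 Glin.
- move=> d s _ _ [a [b [z ->]]] [a' [b' [z' ->]]].
  exists (s *: a + a'), (s *: b + b'), (s *: z + z').
  have sC r (u : K) : s *: (r *: u) = r *: (s *: u) by rewrite !scalerA mulrC.
  by rewrite !scalerDr !(sC (y ^+ _)) !(sC x) addrACA [X in X + _]addrACA.
- move=> d _ [a [b [z ->]]]; exists a, (y *: b), z.
  by rewrite !scalerDr !scalerA addnS -!exprS -!mulrA ![y * (x * _)]mulrCA [y * x]mulrC.
- by move=> d k; exists k, 0, 0; rewrite !scaler0 !addr0.
- by move=> d k; exists 0, k, 0; rewrite !scaler0 add0r addr0.
- by move=> k t i /Gim[].
- by move=> d k t Gk [a [b [z kE]]]; apply: (GV d a b z); rewrite -kE.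
exists h; split=> // k; split=> // -[|j] lt_jm; first exact: h0.
rewrite -(@cfXS _ (h k)) // -linear_mulS (cf_lower (m - j)) -linear_mulS addnS subnK ?(ltnW lt_jm) //.
rewrite -[m in X in cf _ _ X]addn0; apply: (hV 0%N).
exists 0, 0, (y ^+ (m - j).-1 *: k); rewrite !scaler0 !add0r !scalerA.
by rewrite mulrAC -exprD mulrC -subnS add1n subnSK // mulrC.
Qed.

End Extension.

(** * Maps from a CM-module to the three kinds of ideals, taking v to xy *)

Section Retractions.
Variable F : fieldType.
Local Notation S := (ringS F).
Local Notation x := (xS F).
Local Notation y := (yS F).

Lemma x2y_kills (K : lmodType S) (k : K) : y *: (x *: (x *: k)) = 0.
Proof. by rewrite !scalerA -mulrA mulrC xxy0 scale0r. Qed.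

Lemma scalerC (K : lmodType S) (r s : S) (k : K) : r *: (s *: k) = s *: (r *: k).
Proof. by rewrite !scalerA mulrC. Qed.

(** With k least such that y^k occurs in s, the exponent e = n - k moves the leading term of s
    modulo x to y^n. *)
Lemma leading_term (s : S) n : cf s 0 n != 0 ->
  exists e c s' s'', c != 0 /\
    y ^+ e * s = constS c * y ^+ n + y ^+ n.+1 * s' + x * s''.
Proof.
move=> sn; have exk : exists k, cf s 0 k != 0 by exists n.
case: (ex_minnP exk) => k sk kmin; have kn := kmin _ sn.
have [t tdef] : exists t, t = y ^+ (n - k) * s by eexists.
have tE j : cf t 0 j = if (j < n - k)%N then 0 else cf s 0 (j - (n - k))%N.
  by rewrite tdef cfYn.
have t_lt j : (j < n)%N -> cf t 0 j = 0.
  move=> jn; rewrite tE; case: ltnP => // nkj.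
  apply/eqP/negPn/negP => /kmin; rewrite leqNgt => /negP; apply.
  by rewrite ltn_subLR // subnK.
have tn : cf t 0 n = cf s 0 k.
  by rewrite tE ltnNge leq_subr /= subKn.
have [|s'' s''E] := @xdivP F (t - constS (cf s 0 k) * y ^+ n -
    y ^+ n.+1 * mkS (fun i j => cf t 0 (n.+1 + j))).
  move=> j; rewrite !cfB cfC -[y ^+ n]mulr1 !cfYn // cf_1 // ltnS.
  case: ltngtP => [jn|nj|->].
  - by rewrite t_lt // mulr0 !subr0.
  - by rewrite cf_mkS // subn_eq0 leqNgt nj /= mulr0 subr0 subnKC // subrr.
  - by rewrite subnn mulr1 tn subrr subr0.
exists (n - k)%N, (cf s 0 k), (mkS (fun i j => cf t 0 (n.+1 + j))), s''.
by split=> //; rewrite -tdef -s''E [RHS]addrC -[t - _ - _]addrA -opprD subrK.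
Qed.

Lemma cancel_outer (V : zmodType) (u v w : V) : u + v + w - (u + w) = v.
Proof. by rewrite opprD addrACA subrr addr0 addrAC subrr add0r. Qed.

Section CMModule.
Variables (K : lmodType S) (CM_K : CM K).
Implicit Types k v w : K.

Lemma CM_torsion i j k : x ^+ i *: k = 0 -> y ^+ j *: k = 0 -> k = 0.
Proof.
elim: i j k => [|i IHi] j k; first by rewrite scale1r.
elim: j k => [|j IHj] k; first by rewrite scale1r.
move=> xk yk; apply: CM_K.
  by apply: (IHi j.+1); [rewrite scalerA -exprSr | rewrite scalerC yk scaler0].
by apply: IHj; [rewrite scalerC xk scaler0 | rewrite scalerA -exprSr].
Qed.

Variable v : K.
Hypothesis xv : x *: v = 0.

(* As [x v = 0], these say that v lies in psi + phi_m, resp. psi + chi_m. *)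
Definition psi_phi m := exists a z,
  x *: (y *: a) = 0 /\ y ^+ m.+1 *: a + x *: z = y ^+ m *: v.
Definition psi_chi m := exists a z,
  x *: (y *: a) = 0 /\ y ^+ m.+1 *: a + x *: (y *: z) = y ^+ m *: v.

(** Turns a conflict at a multiple k = s v into a relation for y^n v itself; the part of s divisible
    by x disappears because x v = 0. *)
Lemma multiple_leading (s : S) n k : s *: v = k -> cf s 0 n != 0 ->
  exists r a, y ^+ n *: v = y ^+ n.+1 *: a + r *: k.
Proof.
move=> <- /leading_term[e [c [s' [s'' [c0 sE]]]]].
exists (constS c^-1 * y ^+ e), (- (constS c^-1 * s') *: v).
have cE : constS c^-1 * y ^+ e * s =
    y ^+ n + y ^+ n.+1 * (constS c^-1 * s') + constS c^-1 * s'' * x.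
  rewrite -mulrA sE !mulrDr [_ * (constS c * _)]mulrA -rmorphM mulVf // rmorph1.
  by rewrite mul1r [_ * (y ^+ _ * _)]mulrCA -mulrA [s'' * x]mulrC.
rewrite [_ *: (s *: v)]scalerA cE !scalerDl -[(_ * _ * x) *: v]scalerA xv scaler0 addr0.
by rewrite addrCA scalerA mulrN scaleNr addNr addr0.
Qed.

(** Multiplying the relation by xy leaves y^(n+1) (xya) = 0, and x kills xya anyway; so CM gives xya
    = 0. *)
Lemma top_coef_xy n a b :
  y ^+ n *: v = y ^+ n.+1 *: a + x *: b -> x *: (y *: a) = 0.
Proof.
move=> vE; apply: (@CM_torsion 1 n.+1).
  by rewrite expr1 [x *: (y *: a)]scalerC scalerC x2y_kills.
have : y *: (x *: (y ^+ n *: v)) = 0 by rewrite [x *: _]scalerC xv !scaler0.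
rewrite vE !scalerDr x2y_kills addr0 => <-.
by rewrite !(scalerC x) !scalerA -exprSr exprS.
Qed.

(** The map to extend is s v -> xys. That it is well defined is the case a = z = 0 of the
    consistency condition, and any conflict in degree d puts v into psi + phi_d. *)
Lemma retraction_C : (forall d, ~ psi_phi d) ->
  exists h : {linear K -> S^o},
    (forall k, exists u, h k = x * y * u) /\ h v = x * y.
Proof.
move=> vN.
pose G k (t : S) := exists s, k = s *: v /\ t = x * y * s.
have [||||h [him hG]] := @extension_C F K G.
- by exists 0; rewrite scale0r mulr0.
- move=> s _ _ _ _ [r [-> ->]] [r' [-> ->]]; exists (s * r + r').
  by rewrite scalerDl scalerA mulrDr [s * (_ * r)]mulrCA.
- by move=> k t [s [_ ->]]; exists s.
- move=> d a z t [s [sE ->]]; rewrite cfXY /=; apply/eqP/negPn/negP => sd.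
  have [r [a' vE]] := multiple_leading (esym sE) sd.
  have {}vE : y ^+ d *: v = y ^+ d.+1 *: (a' + r *: a) + x *: (r *: z).
    by rewrite vE !scalerDr addrA !(scalerC r).
  by apply: (vN d); exists (a' + r *: a), (r *: z); rewrite -vE (top_coef_xy vE).
exists h; split=> //; apply: hG.
by exists 1; rewrite scale1r mulr1.
Qed.

Lemma retraction_Lam m : ~ psi_chi m ->
  exists h : {linear K -> S^o}, (forall k, lamS m (h k)) /\ h v = x * y.
Proof.
move=> vN.
pose G k (t : S) := exists s, k = s *: v /\ t = x * y * s.
have [||||h [him hG]] := @extension_Lam F K m G.
- by exists 0; rewrite scale0r mulr0.
- move=> s _ _ _ _ [r [-> ->]] [r' [-> ->]]; exists (s * r + r').
  by rewrite scalerDl scalerA mulrDr [s * (_ * r)]mulrCA.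
- by move=> k t [s [_ ->]]; split=> *; rewrite cfXY ?andbF.
- move=> d a b z t [s [sE ->]]; rewrite cfXY /=; apply/eqP/negPn/negP => sd.
  have [r [a' vE]] := multiple_leading (esym sE) sd.
  pose a1 := a' + r *: a; pose b1 := r *: b; pose z1 := r *: z.
  have {}vE : y ^+ (m + d) *: v =
      y ^+ (m + d).+1 *: a1 + x *: (x *: b1) + y ^+ d.+1 *: (x *: z1).
    by rewrite vE !scalerDr !addrA !(scalerC r).
  have a10 : x *: (y *: a1) = 0.
    apply: (@top_coef_xy (m + d) a1 (x *: b1 + y ^+ d.+1 *: z1)).
    by rewrite vE -addrA (scalerC (y ^+ d.+1) x) -scalerDr.
  (* The difference of the two sides is killed by x, and y^d times it is x^2 b1, which y kills; CM
     makes it 0, whatever d is. *)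
  apply: vN; exists a1, z1; split=> //; apply/eqP; rewrite eq_sym -subr_eq0.
  apply/eqP/(@CM_torsion 1 d.+1).
    rewrite expr1 scalerBr scalerDr [x *: (_ *: v)]scalerC xv scaler0.
    rewrite exprSr -scalerA (scalerC x (y ^+ m)) a10 scaler0 !add0r.
    by rewrite (scalerC x y z1) (scalerC x y) x2y_kills oppr0.
  rewrite exprS -scalerA; set D := (X in y *: X).
  suff -> : D = x *: (x *: b1) by rewrite x2y_kills.
  rewrite /D scalerBr scalerDr [_ *: (_ *: v)]scalerA [_ *: (_ *: a1)]scalerA.
  rewrite -!exprD addnS (addnC d) vE (scalerC x y z1) [_ *: (y *: _)]scalerA.
  by rewrite -exprSr cancel_outer.
exists h; split=> //; apply: hG.
by exists 1; rewrite scale1r mulr1.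
Qed.

(* The ideal (xy, x^2 + y^(m+1)). *)
Definition gamS m (s : S) :=
  [/\ forall j, (j <= m)%N -> cf s 0 j = 0, cf s 1 0 = 0
    & cf s 2 0 = cf s 0 m.+1].

(** The coefficients of x y^(m+d+1) in h(y^d x z) and of x^(m+d+2) in h(x^(m+d) z) are those of
    y^(m+1) and x^2 in h(z). The terms in z of A and B thus impose the equation between columns and
    rows that defines the ideal; as column 0 may not vanish, [hom_engine] is used directly. *)
Lemma retraction_Gam m : ~ psi_phi m ->
  exists h : {linear K -> S^o}, (forall k, gamS m (h k)) /\ h v = x * y.
Proof.
move=> vN.
pose W d (A B : K) (c : F) := exists s (a b c' z : K),
  [/\ A = s *: v + y ^+ (m + d).+1 *: a + x *: (x *: b) + y ^+ d *: (x *: z),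
      B = y *: c' - x ^+ (m + d) *: z & c = cf s 0 (m + d)].
have WV d s (a b z c' : K) : W d (s *: v + y ^+ (m + d).+1 *: a + x *: (x *: b) +
    y ^+ d *: (x *: z)) (y *: c' - x ^+ (m + d) *: z) (cf s 0 (m + d)).
  by exists s, a, b, c', z.
have [||d|d k|d k|d k|d k|h [hcol hW]] := @hom_engine F K m W.
- move=> d e _ _ _ _ _ _ [s [a [b [c [z [-> -> ->]]]]]] [s' [a' [b' [c' [z' [-> -> ->]]]]]].
  exists (constS e * s + s'), (constS e *: a + a'), (constS e *: b + b'),
    (constS e *: c + c'), (constS e *: z + z').
  split; last by rewrite cfD cfC.
    rewrite !scalerDr !scalerDl !(scalerC (constS e)) -!scalerA.
    rewrite !(scalerC (constS e)).
    by rewrite addrACA [X in X + _]addrACA [X in X + _ + _]addrACA.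
  by rewrite scalerBr !(scalerC (constS e)) !scalerDr opprD addrACA.
- move=> d _ _ _ [s [a [b [c [z [-> -> ->]]]]]].
  exists (y * s), a, (y *: b), (x *: c), z; rewrite addnS; split.
  + rewrite !scalerDr !scalerA -!exprS; congr (_ + _ + _ *: _ + _ *: _).
    by rewrite -mulrA mulrC.
  + by rewrite scalerBr (scalerC x y) [x *: (x ^+ _ *: _)]scalerA -exprS.
  + by rewrite cfYS.
- move=> [s [a [b [c [z [A0 B0 s1]]]]]].
  have sd : cf s 0 (m + d) != 0 by rewrite -s1 oner_eq0.
  have sE : s *: v = - (y ^+ (m + d).+1 *: a + x *: (x *: b) + y ^+ d *: (x *: z)).
    by apply/eqP; rewrite -addr_eq0 !addrA -A0.
  have [r [a' vE]] := multiple_leading sE sd.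
  pose R := - r; pose a1 := a' + R *: a; pose b1 := R *: b; pose z1 := R *: z.
  have {}vE : y ^+ (m + d) *: v =
      y ^+ (m + d).+1 *: a1 + x *: (x *: b1) + y ^+ d *: (x *: z1).
    rewrite vE scalerN -scaleNr -/R !scalerDr !(scalerC R) -!(scalerC x).
    by rewrite !addrA.
  have a10 : x *: (y *: a1) = 0.
    apply: (@top_coef_xy (m + d) a1 (x *: b1 + y ^+ d *: z1)).
    by rewrite vE -addrA (scalerC (y ^+ d) x) -scalerDr.
  (* x times the difference y^m v - y^(m+1) a1 - x z1 is -x^2 z1. As x^(m+d) z1 is a multiple of y,
     x^(m+d+1) kills the difference, and y^(d+1) kills it too. *)
  have z1E : x ^+ (m + d) *: z1 = y *: (R *: c).
    rewrite scalerC (scalerC y); congr (_ *: _).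
    by apply/eqP; rewrite eq_sym -subr_eq0 -B0.
  apply: vN; exists a1, z1; split=> //; apply/eqP; rewrite eq_sym -subr_eq0.
  apply/eqP/(@CM_torsion (m + d).+1 d.+1).
    have -> : y ^+ m *: v - (y ^+ m.+1 *: a1 + x *: z1) =
        y ^+ m *: (v - y *: a1) - x *: z1.
      by rewrite scalerBr (scalerA (y ^+ m) y) -exprSr opprD addrA.
    rewrite exprSr -scalerA [x *: (_ - _)]scalerBr (scalerC x (y ^+ m)).
    rewrite [x *: (v - _)]scalerBr xv a10 subr0 scaler0 sub0r scalerN.
    by rewrite !(scalerC (x ^+ _) x) z1E !(scalerC x y) x2y_kills oppr0.
  rewrite exprS -scalerA; set D := (X in y *: X).
  suff -> : D = x *: (x *: b1) by rewrite x2y_kills.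
  rewrite /D scalerBr scalerDr [_ *: (_ *: v)]scalerA [_ *: (_ *: a1)]scalerA.
  rewrite -!exprD addnS (addnC d) vE.
  by rewrite cancel_outer.
- have := WV d 0 k 0 0 0.
  by rewrite !scaler0 scale0r oppr0 !addr0 add0r cf0.
- have := WV d 0 0 k 0 0.
  by rewrite !scaler0 scale0r oppr0 !addr0 !add0r cf0.
- have := WV d 0 0 (y ^+ d *: k) (- (x *: k)) 0.
  rewrite !scaler0 scale0r !add0r cf0 !scalerN opprK [x ^+ _ *: (x *: _)]scalerA.
  by rewrite -exprSr !(scalerC (y ^+ d) x) subrr.
- have := WV d 0 0 0 0 k.
  by rewrite !scaler0 scale0r oppr0 !addr0 cf0.
have lowY j k : cf (h k) 1 j.+1 = cf (h (y ^+ m *: k)) 1 (m + j).+1.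
  by rewrite linear_mulS (cf_lower m) addnS.
have hX0 k : cf (h k) 2 0 = cf (h (x ^+ m *: k)) m.+2 0.
  by rewrite linear_mulS -(cfXn m) addn2.
have h0E (k : K) i j : k = 0 -> cf (h k) i j = 0 by move=> ->; rewrite linear0 cf0.
have hY2 k : cf (h k) 2 0 = cf (h (x *: k)) 1 m.+1.
  have := WV 0%N 0 0 0 k 0.
  rewrite !scaler0 !scale0r !add0r scale1r cf0 addn0 => /hW.
  rewrite -scalerN linear_mulS addn0 => /eqP; rewrite addr_eq0 => /eqP ->.
  by rewrite -cfN -[- h _]linearN scalerN opprK hX0 -?linear_mulS.
have row0 k j : cf (h k) 0 j.+1 = cf (h (x *: k)) 1 j.+1.
  by rewrite linear_mulS cfXS.
exists h; split=> [k|].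
  have [h00 h10] := hcol k; split=> //; last by rewrite hY2 row0.
  (* The coefficient of y^(j+1) in h(k) is that of y^(m+1) in h(y^(m-j) k), hence that of x^2 there,
     which the factor y makes 0. *)
  move=> [|j] jm //; rewrite row0 (cf_lower (m - j)) addnS subnK ?(ltnW jm) //.
  rewrite -linear_mulS -scalerC -hY2 linear_mulS.
  by rewrite -(subnSK jm) exprS -mulrA cfY0.
have hv0 i j : cf (x * h v) i j = 0 by rewrite -linear_mulS xv; apply: h0E.
have [h00 h10] := hcol v.
apply: cf_ext => [[|j]|[|j]|i]; rewrite -[x * y]mulr1 cfXY ?h00 ?h10 //=.
- by rewrite row0; apply: h0E.
- rewrite lowY; have := WV j (y ^+ m) 0 0 0 0.
  rewrite !scaler0 oppr0 !addr0 => /hW; rewrite linear0 cf0 addr0 => ->.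
  by rewrite -[y ^+ m]mulr1 cfYn // ltnNge leq_addr addKn.
- by rewrite -(cfXn 1) expr1.
Qed.
End CMModule.
End Retractions.

(** * Splitting *)

Section Submodule.
Variables (A : comNzRingType) (V : lmodType A) (D : {pred V}).
Variable clD : subsemimod_closed D.

(** The closure proof is a parameter of the type so that the module structure can be attached to
    it. *)
Definition submod_of (phD : subsemimod_closed D) : Type := {v : V | v \in D}.
Local Notation submod := (submod_of clD).

HB.instance Definition _ := [isSub of submod for @sval _ _].
HB.instance Definition _ := [Choice of submod by <:].
HB.instance Definition _ :=
  GRing.SubChoice_isSubLmodule.Build A V D submod clD.

Lemma corestrict (K : lmodType A) (h : {linear K -> V}) :
  (forall k, h k \in D) -> exists h' : {linear K -> submod}, forall k, val (h' k) = h k.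
Proof.
move=> hD; pose h0 k : submod := exist _ (h k) (hD k).
have h0lin : linear h0.
  by move=> a u v; apply: val_inj; rewrite linearP /= linearP.
pose h' : {linear K -> submod} :=
  HB.pack h0 (GRing.isLinear.Build A K submod *:%R h0 h0lin).
by exists h'.
Qed.

End Submodule.

Section Splitting.
Variables (A : comNzRingType) (K T : lmodType A).

Lemma lmod_iso_sym (M N : lmodType A) : lmod_iso M N -> lmod_iso N M.
Proof.
move=> [f [g fK gK]].
have glin : linear g.
  by move=> a u v; apply: (can_inj fK); rewrite linearP !gK.
pose g' : {linear N -> M} := HB.pack g (GRing.isLinear.Build A N M *:%R g glin).
by exists g'; exists f.
Qed.

Lemma lmod_iso_trans (M N L : lmodType A) :
  lmod_iso M N -> lmod_iso N L -> lmod_iso M L.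
Proof.
move=> [f bijf] [g bijg].
by exists (g \o f : {linear M -> L}); exact: (bij_comp bijg bijf).
Qed.

(** Relations between h w and h v hold between w and v, so a (h w) + b (h v) -> a w + b v is a
    section of h. Then K is the product of T and the kernel of h, and indecomposability removes the
    kernel. *)
Lemma split_iso (h : {linear K -> T}) (w v : K) :
  indecomposable K -> ~ trivial_lmod T ->
  (forall t, exists a b, t = a *: h w + b *: h v) ->
  (forall a b, a *: h w + b *: h v = 0 -> a *: w + b *: v = 0) ->
  lmod_iso K T.
Proof.
move=> [_ indK] T0 hsurj hrel.
have sec t : exists k, exists a b, k = a *: w + b *: v /\ h k = t.
  have [a [b ->]] := hsurj t; exists (a *: w + b *: v), a, b.
  by rewrite linearD !linearZ.
pose g t := sval (cid (sec t)).
have gN t : exists a b, g t = a *: w + b *: v /\ h (g t) = t.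
  by rewrite /g; case: cid.
have hg t : h (g t) = t by case: (gN t) => a [b []].
have glin : linear g.
  move=> c t t'; apply/eqP; rewrite -subr_eq0; apply/eqP.
  have [[a [b [gt ht]]] [a1 [b1 [gt1 ht1]]]] := (gN t', gN t).
  have [a2 [b2 [gt2 ht2]]] := gN (c *: t + t').
  have E : g (c *: t + t') - (c *: g t + g t') =
      (a2 - (c * a1 + a)) *: w + (b2 - (c * b1 + b)) *: v.
    rewrite gt2 gt1 gt !scalerBl !scalerDl -!scalerA scalerDr.
    rewrite [RHS]addrACA -opprD.
    by congr (_ - _); rewrite addrACA.
  have : h (g (c *: t + t') - (c *: g t + g t')) = 0.
    by rewrite linearB linearD linearZ /= !hg subrr.
  by rewrite E linearD !linearZ; apply: hrel.
pose kerP : {pred K} := fun k => `[< h k = 0 >].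
have clker : subsemimod_closed kerP.
  split; first split.
  - by apply/asboolP; rewrite linear0.
  - by move=> k k' /asboolP hk /asboolP hk'; apply/asboolP; rewrite linearD hk hk' addr0.
  - by move=> a k /asboolP hk; apply/asboolP; rewrite linearZ /= hk scaler0.
pose N : lmodType A := submod_of clker.
have kerE (n : N) : h (val n) = 0 by have /asboolP := valP n.
have kproj k : k - g (h k) \in kerP by apply/asboolP; rewrite linearB hg subrr.
pose f0 k : (T * N)%type := (h k, exist _ (k - g (h k)) (kproj k)).
have f0lin : linear f0.
  move=> a k k'; congr pair; first by rewrite linearP.
  apply: val_inj; rewrite /= !linearP /= glin scalerBr opprD addrACA.
  by congr (_ + _); rewrite -scalerN.
pose f : {linear K -> (T * N)%type} :=
  HB.pack f0 (GRing.isLinear.Build A K (T * N)%type *:%R f0 f0lin).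
have [] := indK T N.
- exists f, (fun p => g p.1 + val p.2) => [k|[t n]] /=; first by rewrite addrC subrK.
  congr pair; first by rewrite linearD hg kerE addr0.
  by apply: val_inj; rewrite /= linearD hg kerE addr0 addrC addKr.
- by [].
move=> N0; exists h, g => // k.
have := N0 (exist _ (k - g (h k)) (kproj k)) => /(congr1 val) /= /eqP.
by rewrite subr_eq0 => /eqP <-.
Qed.

End Splitting.

Section Units.
Variable F : fieldType.
Local Notation S := (ringS F).
Local Notation x := (xS F).
Local Notation y := (yS F).

Lemma cfXlow n (s : S) i j : (i < n)%N -> cf (x ^+ n * s) i j = 0.
Proof.
elim: n i => [//|n IHn] i lt_i; case ij: (inreg i j); last by rewrite /cf ij.
rewrite exprS -mulrA; case: i lt_i ij => [|i] lt_i ij; first by rewrite cfX0.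
by rewrite cfXS // IHn.
Qed.

Lemma xndivP n (s : S) : (forall i j, (i < n)%N -> cf s i j = 0) ->
  exists t, s = x ^+ n * t.
Proof.
elim: n s => [|n IHn] s s0; first by exists s; rewrite mul1r.
have [|t tE] := @xdivP F s; first by move=> j; apply: s0.
(* Multiplication by x kills x y^j for j > 0, so s does not determine these coefficients of t; they
   are reset to 0. *)
have [|t' t'E] := IHn (mkS (fun i j => if inreg i.+1 j then cf t i j else 0)).
  move=> i j lt_i; case ij: (inreg i j); last by rewrite /cf ij.
  rewrite cf_mkS //; case: ifP => // ij1.
  by rewrite -(cfXS _ ij1) -tE s0.
exists t'; rewrite exprS -mulrA -t'E tE.
apply: cf_ext => [j|j|i]; rewrite ?cfX0 ?cfXS ?cf_mkS // /inreg orbT //.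
Qed.

(** The inverse is the geometric series in xu; its coefficients at x^i come from the first i + 1
    terms. *)
Lemma unit_1x (u : S) : exists t, (1 - x * u) * t = 1.
Proof.
pose G n := \sum_(k < n) (x * u) ^+ k.
have Gstab i j n : (i < n)%N -> cf (G n) i j = cf (G i.+1) i j.
  elim: n => // n IHn; rewrite ltnS leq_eqVlt => /orP[/eqP -> //|lt_in].
  by rewrite {1}/G big_ord_recr cfD IHn // exprMn cfXlow // addr0.
pose g := mkS (fun i j => cf (G i.+1) i j).
exists g; apply: cfP => i j ij.
have [|t tE] := @xndivP i.+1 (g - G i.+1).
  move=> k l lt_ki; case kl: (inreg k l); last by rewrite /cf kl.
  by rewrite cfB cf_mkS // Gstab // subrr.
rewrite -[g](subrK (G i.+1)) tE mulrDr mulrCA cfD cfXlow // add0r.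
have -> : (1 - x * u) * G i.+1 = 1 - x ^+ i.+1 * u ^+ i.+1.
  by rewrite -[1 - x * u]opprB mulNr -subrX1 opprB exprMn.
by rewrite cfB cfXlow // subr0.
Qed.

End Units.

Section Ideal2.
Variables (A : comNzRingType) (a b : A).

Definition ideal2_pred : {pred A^o} := fun s => `[< exists u v, s = a * u + b * v >].

Lemma ideal2_closed : subsemimod_closed ideal2_pred.
Proof.
split; first split.
- by apply/asboolP; exists 0, 0; rewrite !mulr0 addr0.
- move=> _ _ /asboolP[u [v ->]] /asboolP[u' [v' ->]]; apply/asboolP.
  by exists (u + u'), (v + v'); rewrite !mulrDr addrACA.
- move=> c _ /asboolP[u [v ->]]; apply/asboolP; exists (c * u), (c * v).
  by rewrite scalerDr ![c *: _]mulrCA.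
Qed.

Definition ideal2 : lmodType A := submod_of ideal2_closed.

Lemma ideal2_iso (K : lmodType A) (h : {linear K -> A^o}) (w v : K) :
  indecomposable K -> b != 0 -> (forall k, exists s t, h k = a * s + b * t) ->
  h w = a -> h v = b ->
  (forall s t, a * s + b * t = 0 -> s *: w + t *: v = 0) ->
  lmod_iso K ideal2.
Proof.
move=> indK b0 him hw hv hrel.
have [|h' h'E] := corestrict (D := ideal2_pred) ideal2_closed (h := h).
  by move=> k; apply/asboolP.
have valE c d (t u : ideal2) : val (c *: t + d *: u) = c * val t + d * val u.
  by rewrite linearD !linearZ.
apply: (@split_iso _ K ideal2 h' w v) => // [triv|t|s t].
- have := triv (h' v) => /(congr1 val); rewrite h'E hv => /eqP.
  by rewrite (negPf b0).
- have /asboolP[s [u tE]] := valP t; exists s, u; apply: val_inj.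
  by rewrite tE valE !h'E hw hv ![_ * s]mulrC ![_ * u]mulrC.
- move=> /(congr1 val); rewrite valE linear0 !h'E hw hv => st0.
  by apply: hrel; rewrite -st0 ![_ * s]mulrC ![_ * t]mulrC.
Qed.

End Ideal2.

Section PrincipalIdeal.
Variables (A : comNzRingType) (a : A).

Lemma pideal_iso (K : lmodType A) (h : {linear K -> A^o}) (v : K) :
  indecomposable K -> a != 0 -> (forall k, exists s, h k = a * s) -> h v = a ->
  (forall s, a * s = 0 -> s *: v = 0) -> lmod_iso K (pideal a).
Proof.
move=> indK a0 him hv hrel.
pose h0 k : pideal a := exist _ (h k) (introT (asboolP _) (him k)).
have h0lin : linear h0.
  by move=> c k l; apply: val_inj; rewrite linearP /= linearP.
pose h' : {linear K -> pideal a} :=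
  HB.pack h0 (GRing.isLinear.Build A K (pideal a) *:%R h0 h0lin).
have h'E k : val (h' k) = h k by [].
have valE c d (t u : pideal a) : val (c *: t + d *: u) = c * val t + d * val u.
  by rewrite linearD !linearZ.
apply: (@split_iso _ K (pideal a) h' 0 v) => // [triv|t|s t].
- have := triv (h' v) => /(congr1 val); rewrite h'E hv => /eqP.
  by rewrite (negPf a0).
- have /asboolP[u tE] := valP t; exists 0, u; apply: val_inj.
  by rewrite valE tE mul0r add0r h'E hv mulrC.
- move=> /(congr1 val); rewrite valE !linear0 mulr0 add0r h'E hv => t0.
  by rewrite add0r hrel // mulrC.
Qed.

End PrincipalIdeal.

(** * Identification of K with C, (xy, y^(m+1)) or (xy, x^2 + y^(m+1)) *)

Section Isomorphisms.
Variable F : fieldType.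
Local Notation S := (ringS F).
Local Notation x := (xS F).
Local Notation y := (yS F).

Definition modLam m : lmodType S := ideal2 (y ^+ m.+1) (x * y).
Definition modGam m : lmodType S := ideal2 (y ^+ m.+1 + x * x) (x * y).

Lemma cf_yn n j : cf (y ^+ n) 0 j = (j == n)%:R :> F.
Proof.
rewrite -[y ^+ n]mulr1 cfYn // cf_1 //; case: ltngtP => [//|nj|->].
  by rewrite subn_eq0 leqNgt nj.
by rewrite subnn.
Qed.

Lemma cfYn_col0 n (s : S) i : cf (y ^+ n.+1 * s) i 0 = 0.
Proof. by rewrite exprS -mulrA cfY0. Qed.

Lemma xy_neq0 : x * y != 0 :> S.
Proof.
apply/eqP => /(congr1 (fun s => cf s 1 1)).
by rewrite -[x * y]mulr1 cfXY cf_1 // cf0 => /eqP; rewrite oner_eq0.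
Qed.

Lemma lamSP m (s : S) : lamS m s <-> exists u v, s = y ^+ m.+1 * u + x * y * v.
Proof.
split=> [[s0 scol]|[u [v ->]]]; last first.
  split=> [j jm|i]; rewrite cfD cfXY ?andbF addr0 ?cfYn_col0 //.
  by rewrite cfYn // ltnS jm.
pose u := mkS (fun i j => if i is 0%N then cf s 0 (m.+1 + j) else 0).
have [||v vE] := @xydivP F (s - y ^+ m.+1 * u).
- move=> j; rewrite cfB cfYn // ltnS; case: leqP => [/s0->|mj]; first by rewrite subrr.
  by rewrite cf_mkS // subnKC // subrr.
- by move=> i; rewrite cfB cfYn_col0 scol subrr.
by exists u, v; rewrite -vE addrC subrK.
Qed.

Lemma gamS_gen m (s : S) : gamS m s ->
  exists u v, s = (y ^+ m.+1 + x * x) * u + x * y * v.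
Proof.
case=> s0 s1 s2.
(* Row 0 of u serves y^(m+1) u and column 0 serves x^2 u; both want the same constant term, by
   [s2]. *)
pose u := mkS (fun i j => match i, j with
  | 0%N, j => cf s 0 (m.+1 + j) | i, 0%N => cf s i.+2 0 | _, _ => 0 end).
have [||v vE] := @xydivP F (s - (y ^+ m.+1 + x * x) * u).
- move=> j; rewrite cfB mulrDl cfD -mulrA cfX0 addr0 cfYn // ltnS.
  case: leqP => [/s0->|mj]; first by rewrite subrr.
  by rewrite cf_mkS // subnKC // subrr.
- move=> i; rewrite cfB mulrDl cfD cfYn_col0 add0r -mulrA.
  case: i => [|[|i]]; first by rewrite s0 // cfX0 subrr.
    by rewrite s1 cfXS // cfX0 subrr.
  rewrite !cfXS ?/inreg ?orbT // cf_mkS ?/inreg ?orbT //.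
  by case: i => [|i]; rewrite ?addn0 ?s2 subrr.
by exists u, v; rewrite -vE addrC subrK.
Qed.

Variable K : lmodType S.
Hypotheses (indK : indecomposable K) (CM_K : CM K).

Lemma iso_C (v : K) : x *: v = 0 -> (forall d, ~ psi_phi v d) ->
  lmod_iso K (modC F).
Proof.
move=> xv vN; have [h [him hv]] := retraction_C CM_K xv vN.
apply: (pideal_iso (v := v) indK xy_neq0 him hv).
by move=> s /ann_xy[e ->]; rewrite mulrC -scalerA xv scaler0.
Qed.

(** From x w = y^m v, h w is y^(m+1) up to a multiple of xy = h v, so w is corrected by a multiple
    of v. The relations between y^(m+1) and xy follow from x y^(m+1) = y^m (xy) and x (xy) = 0,
    which the corrected w and v satisfy. *)
Lemma iso_Lam m (v w : K) : x *: v = 0 -> x *: w = y ^+ m *: v ->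
  ~ psi_chi v m -> lmod_iso K (modLam m).
Proof.
move=> xv xw vN; have [h [him hv]] := retraction_Lam CM_K xv vN.
have [e hw] : exists e, h w - y ^+ m.+1 = x * y * e.
  apply: ann_x; rewrite mulrBr -linear_mulS xw linear_mulS hv mulrCA -exprSr subrr //.
apply: (@ideal2_iso _ _ _ K h (w - e *: v) v) => // [|k||s t].
- exact: xy_neq0.
- by apply/lamSP.
- by rewrite linearB /= linear_mulS hv mulrC -hw subKr.
move=> E; have [|s' sE] := @xdivP F s.
  move=> j; have := congr1 (fun s => cf s 0 (m.+1 + j)) E.
  by rewrite cfD cfXY addr0 cfYn // ltnNge leq_addr /= addKn cf0.
have : x * y * (y ^+ m * s' + t) = 0.
  rewrite mulrDr -E sE; congr (_ + _).
  by rewrite exprS -!mulrA mulrCA; congr (_ * _); rewrite mulrCA mulrC -mulrA mulrCA.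
move=> /ann_xy[c tE].
rewrite sE mulrC -scalerA scalerBr xw [x *: (e *: v)]scalerC xv scaler0 subr0.
by rewrite scalerA -scalerDl [s' * _]mulrC tE mulrC -scalerA xv scaler0.
Qed.

Lemma iso_Gam m (v w : K) : x *: v = 0 -> x *: (y *: w) = y ^+ m.+1 *: v ->
  ~ psi_phi v m -> lmod_iso K (modGam m).
Proof.
move=> xv xw vN; have [h [him hv]] := retraction_Gam CM_K xv vN.
have [w0 _ w2] := him w.
have [e0 e0E] : exists e, h w - y ^+ m.+1 = x * e.
  apply: ann_xy; rewrite mulrBr -mulrA -!linear_mulS xw linear_mulS hv.
  by rewrite [_ ^+ _ * _]mulrC subrr.
have hw0 j : cf (h w) 0 j = (j == m.+1)%:R.
  by rewrite -cf_yn -[h w](subrK (y ^+ m.+1)) e0E cfD cfX0 add0r.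
pose W := y ^+ m.+1 + x * x.
have cfW0 s j : cf (W * s) 0 j = cf (y ^+ m.+1 * s) 0 j.
  by rewrite mulrDl cfD -mulrA cfX0 addr0.
have cfW2 s i : cf (W * s) i.+2 0 = cf s i 0.
  by rewrite mulrDl cfD -mulrA cfYn_col0 add0r !cfXS /inreg ?orbT.
(* Modulo xyS, h w is the generator times [th], a series in x with constant term 1. It is a unit
   whose inverse fixes v, because x v = 0; so w can be rescaled without touching v. *)
pose th := mkS (fun i j => if j is 0%N then
  if i is 0%N then 1 else cf (h w) i.+2 0 else 0).
have th0 j : cf th 0 j = cf 1 0 j by rewrite cf_mkS // cf_1 //; case: j.
have [||et etE] := @xydivP F (h w - W * th).
- move=> j; rewrite cfB cfW0 hw0 -cf_yn -[y ^+ _ in X in X - _]mulr1 !cfYn //.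
  by case: ifP; rewrite ?th0 subrr.
- case=> [|[|i]]; rewrite cfB.
  + by rewrite w0 // cfW0 cfYn_col0 subrr.
  + by case: (him w) => _ -> _; rewrite mulrDl cfD cfYn_col0 -mulrA cfXS // cfX0 addr0 subrr.
  + rewrite cfW2 cf_mkS ?/inreg ?orbT //; case: i => [|i]; last by rewrite subrr.
    by rewrite w2 hw0 eqxx subrr.
have [u uE] : exists u, th - 1 = x * u.
  by apply: xdivP => j; rewrite cfB th0 subrr.
have thE : th = 1 - x * (- u) by rewrite mulrN opprK -uE addrC subrK.
have [ta taE] := unit_1x (- u); rewrite -thE in taE.
have tav : ta *: v = v.
  rewrite -[in RHS](scale1r v) -taE mulrC -scalerA; congr (_ *: _).
  by rewrite thE scalerBl scale1r mulrC -scalerA xv scaler0 subr0.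
apply: (@ideal2_iso _ _ _ K h (ta *: (w - et *: v)) v) => // [|k||s t].
- exact: xy_neq0.
- exact: gamS_gen.
- rewrite linear_mulS linearB /= linear_mulS hv [et * _]mulrC -etE subKr.
  by rewrite mulrC -mulrA taE mulr1.
move=> E; have [||s' sE] := @xydivP F s.
- move=> j; have := congr1 (fun s => cf s 0 (m.+1 + j)) E.
  by rewrite cfD cfXY addr0 cfW0 cfYn // ltnNge leq_addr /= addKn cf0.
- move=> i; have := congr1 (fun s => cf s i.+2 0) E.
  by rewrite cfD cfXY addr0 cfW2 cf0.
have : x * y * (y ^+ m.+1 * s' + t) = 0.
  rewrite mulrDr -E sE; congr (_ + _).
  have x0 : x * x * (x * y * s') = 0.
    transitivity (x * (x * x * y) * s'); first by rewrite !mulrA.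
    by rewrite xxy0 mulr0 mul0r.
  by rewrite mulrDl x0 addr0 mulrCA.
move=> /ann_xy[c tE].
rewrite sE mulrC -!scalerA.
have -> : x *: (y *: (ta *: (w - et *: v))) = y ^+ m.+1 *: v.
  rewrite !(scalerC _ ta) [y *: (_ - _)]scalerBr [x *: (_ - _)]scalerBr xw.
  by rewrite (scalerC y et) (scalerC x et) (scalerC x y) xv !scaler0 subr0 scalerC tav.
by rewrite scalerA -scalerDl [s' * _]mulrC tE mulrC -scalerA xv scaler0.
Qed.
End Isomorphisms.

(** * Points of the spectrum *)

Section PureCombination.
Variables (A : comNzRingType) (M N : lmodType A) (f : {linear M -> N}).

Lemma pure_combination (r1 r2 r3 : A) (m : M) (n1 n2 n3 : N) :
  pure_embedding f -> f m = r1 *: n1 + r2 *: n2 + r3 *: n3 ->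
  exists m1 m2 m3, m = r1 *: m1 + r2 *: m2 + r3 *: m3.
Proof.
move=> [_ fpure] mE; pose E : 'M[A]_(3, 1) := \matrix_(i, _) [:: r1; r2; r3]`_i.
have [|w wE] := fpure 3%N 1%N E (fun _ => m).
  exists (fun i : 'I_3 => nth 0 [:: n1; n2; n3] i) => k.
  by rewrite mE !big_ord_recl big_ord0 !mxE /= addr0 addrA.
exists (w ord0), (w (lift ord0 ord0)), (w (lift ord0 (lift ord0 ord0))).
by rewrite -(wE ord0) !big_ord_recl big_ord0 !mxE /= addr0 addrA.
Qed.

End PureCombination.

Section Points.
Variable F : fieldType.
Local Notation S := (ringS F).
Local Notation x := (xS F).
Local Notation y := (yS F).

(** Row 0 is the image in S/xS = F[[y]], a domain. *)
Lemma mul_row0_neq0 (s t : S) j k : cf s 0 j != 0 -> cf t 0 k != 0 ->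
  exists n, cf (s * t) 0 n != 0.
Proof.
move=> /leading_term[e [c [s' [s'' [c0 sE]]]]] /leading_term[e' [c' [t' [t'' [c0' tE]]]]].
suff : exists n, cf (y ^+ (e + e') * (s * t)) 0 n != 0.
  by move=> [n]; rewrite cfYn //; case: ifP => [|_ nz]; [rewrite eqxx|exists (n - (e + e'))%N].
exists (j + k)%N.
have [u uE] : exists u, u = constS c + y * s' by eexists.
have [u' u'E] : exists u', u' = constS c' + y * t' by eexists.
have -> : y ^+ (e + e') * (s * t) =
    y ^+ (j + k) * (u * u') + x * (y ^+ j * u * t'' + s'' * (y ^+ e' * t)).
  rewrite exprD mulrACA sE.
  have -> : constS c * y ^+ j + y ^+ j.+1 * s' = y ^+ j * u.
    by rewrite uE mulrDr mulrA -exprSr mulrC.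
  rewrite mulrDl [in RHS]mulrDr addrA; congr (_ + _);
    last by rewrite -mulrA.
  rewrite tE; have -> : constS c' * y ^+ k + y ^+ k.+1 * t' = y ^+ k * u'.
    by rewrite u'E mulrDr mulrA -exprSr mulrC.
  by rewrite mulrDr mulrACA -exprD; congr (_ + _); rewrite mulrCA.
rewrite cfD cfX0 addr0 cfYn // ltnn subnn uE u'E mulrDl cfD cfC -mulrA cfY0 addr0.
by rewrite cfD cfY0 addr0 -[constS c']mulr1 cfC cf_1 // mulr1 mulf_neq0.
Qed.

Section EmbeddedModules.
Variables (T : lmodType S) (j : T -> S).
Hypothesis emb_lin : forall s t t', j (s *: t + t') = s * j t + j t'.
Hypothesis emb_inj : injective j.

Lemma emb0 : j 0 = 0.
Proof. by apply/(addrI (j 0)); rewrite -{1}[j 0]mul1r -emb_lin scaler0 !addr0. Qed.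

Lemma embZ s t : j (s *: t) = s * j t.
Proof. by rewrite -[s *: t]addr0 emb_lin emb0 addr0. Qed.

Lemma embD t t' : j (t + t') = j t + j t'.
Proof. by rewrite -[t]scale1r emb_lin mul1r scale1r. Qed.

Lemma lift_along (N : lmodType S) (h : {linear N -> S^o}) :
  (forall n, exists t, j t = h n) ->
  exists h' : {linear N -> T}, forall n, j (h' n) = h n.
Proof.
move=> him; pose h0 n := sval (cid (him n)).
have h0E n : j (h0 n) = h n by rewrite /h0; case: cid.
have h0lin : linear h0.
  by move=> a u v; apply: emb_inj; rewrite emb_lin !h0E linearP.
pose h' : {linear N -> T} := HB.pack h0 (GRing.isLinear.Build S N T *:%R h0 h0lin).
by exists h'.
Qed.

Lemma CM_embedded : CM T.
Proof.
by move=> t xt yt; apply: emb_inj; rewrite emb0;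
  apply: ringS_socle0; rewrite -embZ ?xt ?yt emb0.
Qed.

(** T is uniform: without pure powers of x, every nonzero element has a multiple xyp with p not in
    xS, and two such elements have a common nonzero multiple because F[[y]] is a domain. *)
Lemma indecomposable_embedded : (forall t l, cf (j t) l 0 = 0) ->
  ~ trivial_lmod T -> indecomposable T.
Proof.
move=> col0 T0; split=> // N1 N2 [f [g fK gK]].
have [|/existsNP[n1 n10]] := pselect (trivial_lmod N1); first by left.
have [|/existsNP[n2 n20]] := pselect (trivial_lmod N2); first by right.
exfalso; pose k1 := g (n1, 0); pose k2 := g (0, n2).
have mult k : k <> 0 -> exists r p n, r * j k = x * y * p /\ cf p 0 n != 0.
  move=> k0; have ik0 : j k <> 0 by rewrite -emb0 => /emb_inj.
  have [row0|/existsNP[n /eqP ij]] := pselect (forall n, cf (j k) 0 n = 0).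
    have [p pE] := xydivP row0 (col0 k).
    have [p0|/existsNP[n pn]] := pselect (forall n, cf p 0 n = 0).
      have [p' p'E] := xdivP p0; case: ik0.
      by rewrite pE p'E mulrA [x * y * x]mulrAC xxy0 mul0r.
    by exists 1, p, n; rewrite mul1r; split=> //; apply/eqP.
  have [||p pE] := @xydivP F (x * j k).
  - by move=> l; rewrite cfX0.
  - by move=> [|l]; rewrite ?cfX0 // cfXS ?col0 // /inreg orbT.
  exists x, p, n.-1; split=> //.
  case: n ij => [|n] ij; first by rewrite col0 eqxx in ij.
  by have := cfXY p 1 n.+1; rewrite -pE cfXS //= => <-.
have n0 (k : T) (n : (N1 * N2)%type) : g n = k -> n <> 0 -> k <> 0.
  by move=> <- nn0 gn; apply: nn0; rewrite -[n]gK gn linear0.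
have [|r1 [p1 [j1 [E1 p1j]]]] := mult k1; first by apply: (n0 k1 (n1, 0)) => // -[].
have [|r2 [p2 [j2 [E2 p2j]]]] := mult k2; first by apply: (n0 k2 (0, n2)) => // -[].
have Ek : (p2 * r1) *: k1 = (p1 * r2) *: k2.
  by apply: emb_inj; rewrite !embZ -!mulrA E1 E2 mulrCA mulrA mulrC -!mulrA.
have := congr1 f Ek; rewrite !linearZ /= !gK => -[E _].
have k10 : (p2 * r1) *: k1 = 0.
  apply: (can_inj fK); rewrite linear0 linearZ /= gK.
  by congr pair; rewrite ?scaler0 // E scaler0.
have [n] := mul_row0_neq0 p2j p1j.
have := congr1 (fun k => cf (j k) 1 n.+1) k10.
rewrite embZ -mulrA E1 mulrCA cfXY emb0 cf0 /= => ->.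
by rewrite eqxx.
Qed.

Section C.
Hypothesis im_j : forall s, (exists u, s = x * y * u) <-> exists t, j t = s.

Lemma im_C t : exists u, j t = x * y * u.
Proof. by apply/im_j; exists t. Qed.

Lemma C_coef_kills d (t1 t2 : T) :
  cf (y ^+ d.+1 * j t1 + x * j t2) 1 d.+1 = 0.
Proof.
have [[u1 ->] [u2 ->]] := (im_C t1, im_C t2).
by rewrite cfD cfYn // ltnn subnn cfXY cfXS // cfXY addr0.
Qed.

(** A possible conflict is a relation f b = y^(d+1) a + x z in N. Purity brings it back to M, where
    g maps it to a relation in C, and the coefficient in question vanishes. *)
Lemma pure_injective_C : pure_injective T.
Proof.
move=> M N f fpure g.
pose G (n : N) (t : S) := exists a, n = f a /\ t = j (g a).
have [||||h [him hG]] := @extension_C F N G.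
- by exists 0; rewrite !linear0 emb0.
- move=> s _ _ _ _ [a [-> ->]] [a' [-> ->]]; exists (s *: a + a').
  by rewrite !linearP emb_lin.
- by move=> k t [a [_ ->]]; apply: im_C.
- move=> d a z t [b [bE ->]].
  have bE' : f b = y ^+ d.+1 *: a + x *: z + 0 *: z by rewrite scale0r addr0 bE.
  have [m1 [m2 [m3 ->]]] := pure_combination fpure bE'.
  rewrite scale0r addr0 linearD !linearZ /= embD !embZ.
  exact: C_coef_kills.
have [|h' h'E] := lift_along (h := h); first by move=> n; apply/im_j.
by exists h' => m; apply: emb_inj; rewrite h'E; apply: hG; exists m.
Qed.

End C.

Section Lam.
Variable m : nat.
Hypothesis im_j : forall s, lamS m s <-> exists t, j t = s.

Lemma im_Lam t : lamS m (j t).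
Proof. by apply/im_j; exists t. Qed.

(** For d < m the ideal (xy, y^(m+1)) behaves at x y^(d+1) as C does; this makes C a limit of these
    ideals. *)
Lemma Lam_coef_kills d (t1 t2 : T) : (d < m)%N ->
  cf (y ^+ d.+1 * j t1 + x * j t2) 1 d.+1 = 0.
Proof.
move=> dm; rewrite cfD cfYn // ltnn subnn cfXS //.
by rewrite (im_Lam _).2 (im_Lam _).1 // addr0.
Qed.

Lemma pure_injective_Lam : pure_injective T.
Proof.
move=> M N f fpure g.
pose G (n : N) (t : S) := exists a, n = f a /\ t = j (g a).
have [||||h [him hG]] := @extension_Lam F N m G.
- by exists 0; rewrite !linear0 emb0.
- move=> s _ _ _ _ [a [-> ->]] [a' [-> ->]]; exists (s *: a + a').
  by rewrite !linearP emb_lin.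
- by move=> k t [a [_ ->]]; apply: im_Lam.
- move=> d a b z t [c [cE ->]].
  rewrite !scalerA in cE; have [m1 [m2 [m3 ->]]] := pure_combination fpure (esym cE).
  rewrite !linearD !linearZ /= !embD !embZ !cfD.
  rewrite cfYn // ltnn subnn (im_Lam _).2 -mulrA cfXS // cfX0 !add0r.
  rewrite -mulrA cfYn // ltnS ltnNge leq_addl /= subSS addnK.
  by rewrite cfXS // (im_Lam _).1.
have [|h' h'E] := lift_along (h := h); first by move=> n; apply/im_j.
by exists h' => k; apply: emb_inj; rewrite h'E; apply: hG; exists k.
Qed.

End Lam.
End EmbeddedModules.

End Points.

Section Values.
Variable A : comNzRingType.

Section Principal.
Variable a : A.
Definition pideal_val (t : pideal a) : A := val t.

Lemma pideal_val_lin s t t' :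
  pideal_val (s *: t + t') = s * pideal_val t + pideal_val t'.
Proof. by []. Qed.

Lemma pideal_val_inj : injective pideal_val.
Proof. exact: val_inj. Qed.

Lemma pideal_val_im s : (exists u, s = a * u) <-> exists t, pideal_val t = s.
Proof.
split=> [su|[t <-]]; last by have /asboolP := valP t.
by exists (exist _ s (introT (asboolP _) su)).
Qed.
End Principal.

Section TwoGenerators.
Variables a b : A.
Definition ideal2_val (t : ideal2 a b) : A := val t.

Lemma ideal2_val_lin s t t' :
  ideal2_val (s *: t + t') = s * ideal2_val t + ideal2_val t'.
Proof. by []. Qed.

Lemma ideal2_val_inj : injective ideal2_val.
Proof. exact: val_inj. Qed.

Lemma ideal2_val_im s :
  (exists u v, s = a * u + b * v) <-> exists t, ideal2_val t = s.
Proof.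
split=> [su|[t <-]]; last by have /asboolP := valP t.
by exists (exist _ s (introT (asboolP _) su)).
Qed.
End TwoGenerators.

Lemma pp_sat_linear (phi : ppform A) (K L : lmodType A) (f : {linear K -> L}) k :
  pp_sat phi k -> pp_sat phi (f k).
Proof.
move=> [w wE]; exists (fun i => f (w i)) => j.
have := congr1 f (wE j); rewrite linear_sum linearZ => <-.
by apply: eq_bigr => i _; rewrite linearZ.
Qed.

Lemma pp_sat_embedded (phi : ppform A) (K : lmodType A) (j : K -> A) k :
  (forall s t t', j (s *: t + t') = s * j t + j t') -> pp_sat phi k ->
  exists u : 'I_(pp_vars phi) -> K, forall e,
    \sum_i pp_mx phi i e * j (u i) = pp_row phi 0 e * j k.
Proof.
move=> jlin [w wE]; exists w => e.
have [j' j'E] : exists j' : {linear K -> A^o}, forall k, j' k = j k.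
  have jlin' : linear (j : K -> A^o) by [].
  pose j' : {linear K -> A^o} :=
    HB.pack (j : K -> A^o) (GRing.isLinear.Build A K A^o *:%R j jlin').
  by exists j'.
have := congr1 j' (wE e); rewrite linear_sum linearZ j'E => <-.
by apply: eq_bigr => i _; rewrite linearZ j'E.
Qed.

End Values.

(** * C is a limit of the ideals (xy, y^(m+1)) *)

Section Limit.
Variable F : fieldType.
Local Notation S := (ringS F).
Local Notation x := (xS F).
Local Notation y := (yS F).

Definition valC : modC F -> S := @pideal_val S (x * y).
Definition valLam m : modLam F m -> S := @ideal2_val S (y ^+ m.+1) (x * y).

Lemma valC_lin s (t t' : modC F) : valC (s *: t + t') = s * valC t + valC t'.
Proof. exact: pideal_val_lin. Qed.
Lemma valC_inj : injective valC.
Proof. exact: pideal_val_inj. Qed.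
Lemma valC_im s : (exists u, s = x * y * u) <-> exists t, valC t = s.
Proof. exact: pideal_val_im. Qed.
Lemma valLam_lin m s (t t' : modLam F m) : valLam (s *: t + t') = s * valLam t + valLam t'.
Proof. exact: ideal2_val_lin. Qed.
Lemma valLam_inj m : injective (@valLam m).
Proof. exact: ideal2_val_inj. Qed.
Lemma valLam_im m s : lamS m s <-> exists t : modLam F m, valLam t = s.
Proof. by rewrite lamSP; exact: ideal2_val_im. Qed.

Lemma ZCM_C : ZCM (modC F).
Proof.
have [t1 t1E] : exists t, valC t = x * y by apply/valC_im; exists 1; rewrite mulr1.
split.
- apply: (indecomposable_embedded valC_lin valC_inj) => [t l|triv].
    by have [u ->] := im_C valC_im t; rewrite cfXY andbF.
  by have := xy_neq0 F; rewrite -t1E (triv t1) (emb0 valC_lin) eqxx.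
- exact: (pure_injective_C valC_lin valC_inj valC_im).
- exact: (CM_embedded valC_lin valC_inj).
Qed.

Lemma ZCM_Lam m : ZCM (modLam F m).
Proof.
have [t1 t1E] : exists t : modLam F m, valLam t = x * y.
  by apply/valLam_im; apply/lamSP; exists 0, 1; rewrite mulr0 add0r mulr1.
split.
- apply: (indecomposable_embedded (@valLam_lin m) (@valLam_inj m)) => [t l|triv].
    exact: (im_Lam (@valLam_im m) t).2.
  by have := xy_neq0 F; rewrite -t1E (triv t1) (emb0 (@valLam_lin m)) eqxx.
- exact: (pure_injective_Lam (@valLam_lin m) (@valLam_inj m) (@valLam_im m)).
- exact: (CM_embedded (@valLam_lin m) (@valLam_inj m)).
Qed.

Lemma cf_sum (I : Type) (r : seq I) (f : I -> S) a b :
  cf (\sum_(i <- r) f i) a b = \sum_(i <- r) cf (f i) a b.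
Proof. by apply: (big_morph (fun s => cf s a b) (fun s t => cfD s t a b) (cf0 _ a b)). Qed.

(** Solving psi at c means extending to S^n a partial homomorphism into C given on the combinations
    of the equations. Its obstruction in degree d concerns only x y^(d+1), and a solution in (xy,
    y^(d+2)) already makes it vanish. *)
Lemma modC_limit (psi : ppform S) (c : modC F) (cm : forall m, modLam F m) :
  (forall m, valLam (cm m) = valC c) -> (forall m, pp_sat psi (cm m)) -> pp_sat psi c.
Proof.
move=> cmE cm_sat; set n := pp_vars psi in cm_sat *; set E := pp_mx psi.
pose G (r : 'rV[S]_n) (t : S) := exists s : 'I_(pp_eqns psi) -> S,
  (forall i, r 0 i = \sum_k s k * E i k) /\
  t = \sum_k s k * (pp_row psi 0 k * valC c).
have [||||h [him hG]] := @extension_C F 'rV[S]_n G.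
- exists (fun _ => 0); split=> [i|]; rewrite ?mxE big1 // => k _; exact: mul0r.
- move=> s k1 _ k2 _ [s1 [r1E ->]] [s2 [r2E ->]]; exists (fun k => s * s1 k + s2 k).
  split=> [i|]; rewrite ?mxE ?r1E ?r2E mulr_sumr -big_split /=;
    by apply: eq_bigr => k _; rewrite mulrDl mulrA.
- move=> k t [s [_ ->]]; have [u ->] := im_C valC_im c.
  exists (\sum_k s k * (pp_row psi 0 k * u)).
  by rewrite mulr_sumr; apply: eq_bigr => i _; rewrite ![_ * (x * y * _)]mulrCA.
- move=> d a z t [s [rE ->]].
  have [w wE] := pp_sat_embedded (@valLam_lin d.+1) (cm_sat d.+1).
  have -> : \sum_k s k * (pp_row psi 0 k * valC c) =
      \sum_i (y ^+ d.+1 * valLam (a 0 i *: w i) + x * valLam (z 0 i *: w i)).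
    transitivity (\sum_k \sum_i s k * E i k * valLam (w i)).
      apply: eq_bigr => k _; rewrite -(cmE d.+1) -wE mulr_sumr.
      by apply: eq_bigr => i _; rewrite mulrA.
    rewrite exchange_big; apply: eq_bigr => i _.
    rewrite -mulr_suml -rE !mxE !(embZ (@valLam_lin d.+1)) !mulrA -mulrDl //.
  rewrite cf_sum big1 // => i _.
  exact: (Lam_coef_kills (@valLam_im d.+1)).
have [h' h'E] := lift_along valC_lin valC_inj (fun k => (valC_im _).1 (him k)).
exists (fun i => h' (delta_mx 0 i)) => k.
apply: valC_inj; rewrite (embZ valC_lin).
have <- : h (row k E^T) = pp_row psi 0 k * valC c.
  apply: hG; exists (fun l => (l == k)%:R); split=> [i|].
    rewrite !mxE (bigD1 k) //= eqxx mul1r big1 ?addr0 // => l /negPf ->.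
    exact: mul0r.
  rewrite (bigD1 k) //= eqxx mul1r big1 ?addr0 // => l /negPf ->.
  exact: mul0r.
rewrite -h'E; congr (valC _).
rewrite [row k _]row_sum_delta linear_sum; apply: eq_bigr => i _.
by rewrite linearZ !mxE.
Qed.

Lemma modC_not_isolated : ~ isolated_in (@ZCM F) (@ZCM F) (modC F).
Proof.
move=> [ZC [U [[B BE] UE]]].
have isoC : lmod_iso (modC F) (modC F).
  by exists (idfun : {linear modC F -> modC F}); exists idfun.
have /(BE _ ZC)[phi [psi [Bpp]]] : U (modC F) by apply/UE.
move=> /existsNP[c /not_implyP[phic]]; apply.
have cm m : exists t : modLam F m, valLam t = valC c.
  apply/valLam_im/lamSP; have [u ->] := im_C valC_im c.
  by exists 0, u; rewrite mulr0 add0r.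
apply: (@modC_limit _ _ (fun m => sval (cid (cm m)))) => m; first by case: cid.
(* If psi failed at t, this ideal would lie in U and be isomorphic to C; but x kills C and does not
   kill y^(m+1). *)
case: cid => t tE /=; apply: contrapT => psit.
have incl : exists f : {linear modC F -> modLam F m}, f c = t.
  have [h hE] : exists h : {linear modC F -> S^o}, forall k, h k = valC k.
    have jlin : linear (valC : modC F -> S^o) by exact: valC_lin.
    pose h : {linear modC F -> S^o} :=
      HB.pack (valC : modC F -> S^o) (GRing.isLinear.Build S (modC F) S^o *:%R valC jlin).
    by exists h.
  have [k|f fE] := lift_along (@valLam_lin m) (@valLam_inj m) (h := h).
    apply/valLam_im/lamSP; have [u uE] := im_C valC_im k.
    by exists 0, u; rewrite mulr0 add0r hE uE.
  by exists f; apply: valLam_inj; rewrite fE hE tE.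
have [f ft] := incl.
have /(UE _ (ZCM_Lam m))[g [g' gK g'K]] : U (modLam F m).
  apply/(BE _ (ZCM_Lam m)); exists phi, psi; split=> // sub; apply: psit.
  by apply: sub; rewrite -ft; apply: pp_sat_linear.
have [t1 t1E] : exists t : modLam F m, valLam t = y ^+ m.+1.
  by apply/valLam_im; apply/lamSP; exists 1, 0; rewrite mulr0 addr0 mulr1.
have xC0 (k : modC F) : x *: k = 0.
  apply: valC_inj; rewrite (embZ valC_lin) (emb0 valC_lin); have [u ->] := im_C valC_im k.
  by rewrite !mulrA xxy0 mul0r.
have : x *: t1 = 0 by apply: (can_inj gK); rewrite linear0 linearZ; exact: xC0.
move=> /(congr1 (@valLam m)); rewrite (embZ (@valLam_lin m)) (emb0 (@valLam_lin m)) t1E.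
move=> /(congr1 (fun s => cf s 1 m.+1)); rewrite cfXS // cf_yn eqxx cf0 => /eqP.
by rewrite oner_eq0.
Qed.
End Limit.

(** * Formulae and classification *)

Section Transport.
Variable A : comNzRingType.

Lemma pair_open_iso (phi psi : ppform A) (K K' : lmodType A) :
  lmod_iso K K' -> pair_open phi psi K -> pair_open phi psi K'.
Proof.
move=> [f [g fK gK]] open_K sub; apply: open_K => v phiv.
have [g' g'E] : exists g' : {linear K' -> K}, forall k, g' k = g k.
  have glin : linear g.
    by move=> a u u'; apply: (can_inj fK); rewrite linearP !gK.
  pose g' : {linear K' -> K} := HB.pack g (GRing.isLinear.Build A K' K *:%R g glin).
  by exists g'.
by rewrite -(fK v) -g'E; apply/pp_sat_linear/sub/pp_sat_linear.
Qed.

End Transport.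

Section Formulas.
Variables (A : comNzRingType) (x y : A).

Definition pp_ann : ppform A := @PPForm A 0 1 0 (const_mx x).

Definition pp_divann : ppform A := @PPForm A 1 2
  (\matrix_(i, j) [:: y; x * y]`_j) (\row_j [:: 1; 0]`_j).

(* [x v = 0] and [y^m v] is a multiple of [r]: phi_m for [r = x], chi_m for
   [r = x * y]. *)
Definition pp_div (r : A) m : ppform A := @PPForm A 1 2
  (\matrix_(i, j) [:: 0; r]`_j) (\row_j [:: x; y ^+ m]`_j).

(* The sum of [pp_divann] and [pp_div r m]. *)
Definition pp_sum (r : A) m : ppform A := @PPForm A 2 3
  (\matrix_(i, j) (nth [::] [:: [:: 0; x * y; y ^+ m.+1]; [:: 0; 0; r]] i)`_j)
  (\row_j [:: x; 0; y ^+ m]`_j).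

Variable K : lmodType A.
Implicit Types v w a z : K.

Lemma pp_ann_sat v : pp_sat pp_ann v <-> x *: v = 0.
Proof.
split=> [[w /(_ ord0)]|xv]; first by rewrite big_ord0 mxE => <-.
by exists (fun _ => 0) => j; rewrite big_ord0 mxE.
Qed.

Lemma pp_divann_sat v : pp_sat pp_divann v <-> exists u, y *: u = v /\ x *: (y *: u) = 0.
Proof.
split=> [[w wE]|[u [uE xyu]]].
  exists (w ord0); have := wE ord0; have := wE (lift ord0 ord0).
  by rewrite !big_ord1 !mxE /= scale0r scale1r -scalerA.
exists (fun _ => u) => j; rewrite big_ord1 !mxE.
by case: j => -[|[|//]] jlt /=; rewrite ?scale1r ?scale0r -?scalerA.
Qed.

Lemma pp_div_sat r m v : pp_sat (pp_div r m) v <->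
  x *: v = 0 /\ exists w, r *: w = y ^+ m *: v.
Proof.
split=> [[w wE]|[xv [w wE]]].
  have := wE ord0; have := wE (lift ord0 ord0).
  by rewrite !big_ord1 !mxE /= scale0r => wE1 <-; split=> //; exists (w ord0).
exists (fun _ => w) => j; rewrite big_ord1 !mxE.
by case: j => -[|[|//]] jlt /=; rewrite ?scale0r ?xv.
Qed.

Lemma pp_sum_sat r m v : pp_sat (pp_sum r m) v <->
  x *: v = 0 /\ exists a z,
    x *: (y *: a) = 0 /\ y ^+ m.+1 *: a + r *: z = y ^+ m *: v.
Proof.
split=> [[w wE]|[xv [a [z [xya azE]]]]].
  have := wE ord0; have := wE (lift ord0 ord0); have := wE (lift ord0 (lift ord0 ord0)).
  rewrite !big_ord_recl !big_ord0 !mxE /= !addr0 !scale0r !addr0 => wE2 wE1 <-.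
  by split=> //; exists (w ord0), (w (lift ord0 ord0)); rewrite scalerA.
exists (fun i : 'I_2 => nth 0 [:: a; z] i) => j.
rewrite !big_ord_recl !big_ord0 !mxE addr0.
by case: j => -[|[|[|//]]] jlt /=; rewrite ?scale0r ?xv ?addr0 // -scalerA.
Qed.

(** Subtracting y a changes v by an element of psi only, and turns membership in the sum into
    divisibility of y^m v' by r. *)
Lemma pp_divann_reduce r m v : x *: v = 0 -> ~ pp_sat pp_divann v ->
  (exists a z, x *: (y *: a) = 0 /\ y ^+ m.+1 *: a + r *: z = y ^+ m *: v) ->
  exists v' w, [/\ x *: v' = 0, ~ pp_sat pp_divann v' & r *: w = y ^+ m *: v'].
Proof.
move=> xv vN [a [z [xya azE]]]; exists (v - y *: a), z; split.
- by rewrite scalerBr xv xya subr0.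
- move=> /pp_divann_sat[u [uE xyu]]; apply: vN; apply/pp_divann_sat; exists (a + u).
  by rewrite !scalerDr xya xyu addr0 uE addrC subrK.
- by rewrite scalerBr -azE scalerA -exprSr addrC addKr.
Qed.

End Formulas.

Section Classification.
Variable F : fieldType.
Local Notation S := (ringS F).
Local Notation x := (xS F).
Local Notation y := (yS F).

Lemma isolated_by_pair (phi psi : ppform S) (K L : lmodType S) :
  ZCM K -> pair_open phi psi K ->
  (forall K', ZCM K' -> pair_open phi psi K' -> lmod_iso K' L) ->
  isolated_in (@ZCM F) (@ZCM F) K.
Proof.
move=> ZK openK isoL; split=> //; exists (pair_open phi psi); split.
  exists (fun phi' psi' => phi' = phi /\ psi' = psi) => K' _; split.
    by exists phi, psi.
  by move=> [_ [_ [[-> ->]]]].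
move=> K' ZK'; split=> [openK'|isoK].
  exact: lmod_iso_trans (isoL _ ZK' openK') (lmod_iso_sym (isoL _ ZK openK)).
exact: pair_open_iso (lmod_iso_sym isoK) openK.
Qed.

Lemma iso_modLam m (K : lmodType S) : ZCM K ->
  pair_open (pp_div x y x m) (pp_sum x y (x * y) m) K -> lmod_iso K (modLam F m).
Proof.
move=> [indK _ CMK] /existsNP[v /not_implyP[/pp_div_sat[xv [w wE]] vN]].
apply: (iso_Lam indK CMK xv wE) => -[a [z [xya azE]]]; apply: vN.
by apply/pp_sum_sat; split=> //; exists a, z; rewrite -scalerA.
Qed.

Lemma iso_modGam m (K : lmodType S) : ZCM K ->
  pair_open (pp_div x y (x * y) m.+1) (pp_sum x y x m) K -> lmod_iso K (modGam F m).
Proof.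
move=> [indK _ CMK] /existsNP[v /not_implyP[/pp_div_sat[xv [w wE]] vN]].
apply: (iso_Gam indK CMK xv (w := w)); first by rewrite scalerA.
by move=> azE; apply: vN; apply/pp_sum_sat.
Qed.

Lemma classification (K : lmodType S) : ZCM K -> pair_open (pp_ann x) (pp_divann x y) K ->
  lmod_iso K (modC F) \/ isolated_in (@ZCM F) (@ZCM F) K.
Proof.
move=> ZK /existsNP[v /not_implyP[/pp_ann_sat xv vN]].
pose r n : S := if odd n then x else x * y.
(* The position n in the chain is 2m for chi_m and 2m + 1 for phi_m; the least n with [Q n] gives
   the consecutive pair that K opens. *)
pose Q n := exists v w : K,
  [/\ x *: v = 0, ~ pp_sat (pp_divann x y) v & r n *: w = y ^+ n./2 *: v].
have [nQ|/existsNP[n0 /contrapT Qn0]] := pselect (forall n, ~ Q n).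
  left; have [indK _ CMK] := ZK; apply: (iso_C indK CMK xv) => d vd.
  apply: (nQ d.*2.+1); rewrite /Q /r /= odd_double /= uphalf_double.
  exact: (pp_divann_reduce (v := v)).
have [] := @ex_minnP (fun n => `[< Q n >]); first by exists n0; apply/asboolP.
move=> n /asboolP[v1 [w [xv1 v1N wE]]] nmin; right.
have [m [odd_n nE]] : exists m, n = (odd n + m.*2)%N /\ n./2 = m.
  by exists n./2; rewrite odd_double_half.
rewrite nE /r in wE; case: (odd n) odd_n wE => [nm wE|nm wE].
  apply: (@isolated_by_pair (pp_div x y x m) (pp_sum x y (x * y) m) _ (modLam F m)) => //.
    move=> sub; have /sub/pp_sum_sat[_ azE] : pp_sat (pp_div x y x m) v1.
      by apply/pp_div_sat; split=> //; exists w.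
    have /asboolP/nmin : Q m.*2.
      by rewrite /Q /r odd_double doubleK; apply: (pp_divann_reduce (v := v1)).
    by rewrite nm add1n ltnn.
  exact: iso_modLam.
(* Position 0 cannot be the least one: chi_0 says v = xyw = y(xw), which is in psi. *)
case: m => [|m] in nE nm wE *.
  case: v1N; apply/pp_divann_sat; exists (x *: w).
  rewrite (scalerC x y) x2y_kills; split=> //.
  by move: wE; rewrite expr0 scale1r scalerA mulrC.
apply: (@isolated_by_pair (pp_div x y (x * y) m.+1) (pp_sum x y x m) _ (modGam F m)) => //.
  move=> sub; have /sub/pp_sum_sat[_ azE] : pp_sat (pp_div x y (x * y) m.+1) v1.
    by apply/pp_div_sat; split=> //; exists w.
  have /asboolP/nmin : Q m.*2.+1.
    by rewrite /Q /r /= odd_double uphalf_double; apply: (pp_divann_reduce (v := v1)).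
  by rewrite nm doubleS add0n ltnn.
exact: iso_modGam.
Qed.
End Classification.

(** * The formulae of the pointed modules (C, xy) and (D, xy) *)

Section FreeRealizations.
Variables (A : comNzRingType) (x y : A).

(** aS is presented by the generator a and the relation x a = 0. Writing a solution of psi in aS as
    a t_i, the t_i solve each equation modulo x, so the t_i v solve it at any v killed by x. *)
Lemma generates_pp_ann (a : A) (g : pideal a) : pideal_val g = a -> x * a = 0 ->
  (forall s, a * s = 0 -> exists t, s = x * t) -> generates_pptype (pp_ann x) g.
Proof.
move=> ga xa ann_a; split.
  by apply/pp_ann_sat; apply: pideal_val_inj; rewrite -[x *: g]addr0
    pideal_val_lin ga xa add0r.
move=> psi /(pp_sat_embedded (@pideal_val_lin _ a))[u uE] K v /pp_ann_sat xv.
have /boolp.choice[t tE] i : exists t, pideal_val (u i) = a * t.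
  by apply/pideal_val_im; exists (u i).
exists (fun i => t i *: v) => e.
have [|r rE] := ann_a (\sum_i pp_mx psi i e * t i - pp_row psi 0 e).
  rewrite mulrBr [a * pp_row _ _ _]mulrC -{2}ga -uE mulr_sumr; apply/eqP.
  by rewrite subr_eq0; apply/eqP/eq_bigr => i _; rewrite tE mulrCA.
apply/eqP; rewrite -subr_eq0; apply/eqP.
transitivity ((x * r) *: v); last by rewrite mulrC -scalerA xv scaler0.
rewrite -rE scalerBl scaler_suml; congr (_ - _).
by apply: eq_bigr => i _; rewrite scalerA.
Qed.

(** The same with xS, presented by one generator killed by xy, and its element y times the
    generator. *)
Lemma generates_pp_divann (d : pideal x) : pideal_val d = x * y ->
  x * (x * y) = 0 ->
  (forall s, x * s = 0 -> exists t, s = x * y * t) -> generates_pptype (pp_divann x y) d.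
Proof.
move=> dE xxy ann_x; split.
  have [g gE] : exists g : pideal x, pideal_val g = x.
    by apply/pideal_val_im; exists 1; rewrite mulr1.
  have valZ s (k : pideal x) : pideal_val (s *: k) = s * pideal_val k.
    by rewrite -[s *: k]addr0 pideal_val_lin addr0.
  apply/pp_divann_sat; exists g; split; apply: pideal_val_inj.
    by rewrite valZ gE dE mulrC.
  by rewrite !valZ gE [y * x]mulrC xxy.
move=> psi /(pp_sat_embedded (@pideal_val_lin _ x))[u uE] K v.
move=> /pp_divann_sat[k [<- xyk]].
have /boolp.choice[t tE] i : exists t, pideal_val (u i) = x * t.
  by apply/pideal_val_im; exists (u i).
exists (fun i => t i *: k) => e.
have [|r rE] := ann_x (\sum_i pp_mx psi i e * t i - pp_row psi 0 e * y).
  rewrite mulrBr [x * (_ * y)]mulrCA -dE -uE mulr_sumr; apply/eqP.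
  by rewrite subr_eq0; apply/eqP/eq_bigr => i _; rewrite tE mulrCA.
apply/eqP; rewrite -subr_eq0; apply/eqP.
transitivity ((x * y * r) *: k); last by rewrite mulrC -!scalerA xyk scaler0.
rewrite -rE scalerBl scaler_suml scalerA; congr (_ - _).
by apply: eq_bigr => i _; rewrite scalerA.
Qed.

End FreeRealizations.

(** * Minimality of the pair and isolation of C in the derivative *)

Section MinimalPair.
Variable F : fieldType.
Local Notation S := (ringS F).
Local Notation x := (xS F).
Local Notation y := (yS F).

Lemma valC_xyC : valC (xyC F) = x * y.
Proof. by []. Qed.

Lemma x_kills_C (c : modC F) : x *: c = 0.
Proof.
apply: valC_inj; rewrite (embZ (@valC_lin F)) (emb0 (@valC_lin F)).
by have [u ->] := im_C (@valC_im F) c; rewrite !mulrA xxy0 mul0r.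
Qed.

Lemma xyC_multiples (c : modC F) : exists u, c = u *: xyC F.
Proof.
have [u uE] := im_C (@valC_im F) c; exists u; apply: valC_inj.
by rewrite (embZ (@valC_lin F)) valC_xyC uE mulrC.
Qed.

Lemma open_C : pair_open (pp_ann x) (pp_divann x y) (modC F).
Proof.
move=> sub; have /sub/pp_divann_sat[u [uE _]] : pp_sat (pp_ann x) (xyC F).
  by apply/pp_ann_sat; apply: x_kills_C.
have [s sE] := im_C (@valC_im F) u.
have := congr1 (@valC F) uE; rewrite (embZ (@valC_lin F)) sE valC_xyC.
move=> /(congr1 (fun s => cf s 1 1)); rewrite cfYS // cfXY -[x * y]mulr1 cfXY cf_1 //=.
by move=> /esym/eqP; rewrite oner_eq0.
Qed.

(* [retraction_C] applied to C itself maps [c] to xy. *)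
Lemma C_generator (theta : ppform S) (c c' : modC F) :
  pp_sat theta c -> ~ pp_sat (pp_divann x y) c -> pp_sat theta c'.
Proof.
move=> thc cN; have CMC := CM_embedded (@valC_lin F) (@valC_inj F).
have [d [a [z [xya azE]]]|h [him hc]] := retraction_C CMC (x_kills_C c).
  apply: cN; apply/pp_divann_sat; exists a; split=> //.
  apply/eqP; rewrite -subr_eq0; apply/eqP/(CM_torsion CMC (i := 1) (j := d)).
    by rewrite expr1 x_kills_C.
  rewrite scalerBr scalerA -exprSr -azE x_kills_C addr0 subrr //.
have [f fE] := lift_along (@valC_lin F) (@valC_inj F) (fun k => (valC_im _).1 (him k)).
have fc : f c = xyC F by apply: valC_inj; rewrite fE hc.
have [u ->] := xyC_multiples c'.
by rewrite -fc -linearZ; apply: pp_sat_linear; apply: (pp_sat_linear (u \*: idfun)).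
Qed.

Lemma isolated_C : isolated_by (@T_CM1 F) (modC F) (pp_ann x) (pp_divann x y).
Proof.
split=> [|K [ZK notK]]; first by split; [exact: ZCM_C|exact: modC_not_isolated].
split=> [/(classification ZK)[//|/notK //]|/lmod_iso_sym isoK].
exact: pair_open_iso isoK (@open_C).
Qed.

(** For theta strictly between, both theta / psi and phi / theta would open at points of (phi /
    psi), hence at C. The first gives an element of theta(C) outside psi(C), so theta(C) = C by
    [C_generator], against the second. *)
Lemma minimal_C : minimal_pair (@T_CM1 F) (pp_ann x) (pp_divann x y).
Proof.
have [TC isoC] := isolated_C.
split; first split.
- move=> K _ v /pp_divann_sat[u [<- xyu]]; exact/pp_ann_sat.
- by move=> le; apply: open_C; apply: le.
move=> [theta [[le1 nle1] [le2 nle2]]]; apply: nle1 => K TK.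
apply: contrapT => openK.
have isoK : lmod_iso K (modC F).
  apply/(isoC K TK) => sub; apply: openK => v thv; apply: sub; exact: (le2 K TK).
have /existsNP[c /not_implyP[thc cN]] := pair_open_iso isoK openK.
apply: nle2 => K' TK' v annv; apply: contrapT => thN.
have openK' : pair_open (pp_ann x) theta K' by move=> sub; apply/thN/sub.
have isoK' : lmod_iso K' (modC F).
  apply/(isoC K' TK') => sub; apply: openK' => v' /sub; exact: (le1 K' TK').
by apply: (pair_open_iso isoK' openK') => c' _; apply: C_generator thc cN.
Qed.

End MinimalPair.

Theorem lemma7p4 (F : closedFieldType) (charF : 2%N \notin [pchar F]) :
  (exists phi psi : ppform (ringS F),
     [/\ generates_pptype phi (xyC F),
         generates_pptype psi (xyD F),
         minimal_pair (@T_CM1 F) phi psi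
       & isolated_by (@T_CM1 F) (modC F) phi psi]) /\
  cb_rank (@ZCM F) (modC F) 1.
Proof.
have [TC isoC] := isolated_C F.
split.
  exists (pp_ann (xS F)), (pp_divann (xS F) (yS F)); split.
  - apply: generates_pp_ann; first exact: valC_xyC; first by rewrite mulrA xxy0.
    exact: ann_xy.
  - by apply: generates_pp_divann; [|rewrite mulrA xxy0|exact: ann_x].
  - exact: minimal_C.
  - by [].
split=> //; exists (pair_open (pp_ann (xS F)) (pp_divann (xS F) (yS F))); split=> //.
exists (fun phi psi => phi = pp_ann (xS F) /\ psi = pp_divann (xS F) (yS F)) => K _.
split=> [openK|[_ [_ [[-> ->]]]] //].
by exists (pp_ann (xS F)), (pp_divann (xS F) (yS F)).
Qed.
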